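(* Let $\vec G$ be an orientation of the Coxeter diagram $s_0\overset{4}{-}s_1-\cdots-s_{n-1}$ of $B_n$, with up and down indices in $\pm[n]$ determined as described below. Then the Cambrian lattice $\mathcal C(\vec G)$ is isomorphic to the subposet of the weak order on $B_n$ consisting of the signed permutations whose full notation, regarded as a permutation of $\pm[n]$, avoids $\bar{2}31$.
   Context: $B_n$: signed permutations $x$ of $\pm[n]$ ($x(-i)=-x(i)$), full notation $x_{-n},\dots,x_{-1},x_1,\dots,x_n$; generators $s_0=(-1\ 1)$, $s_i=(i\ i{+}1)(-i{-}1\ {-i})$. Weak order $v\le w$ iff $I(v)\subseteq I(w)$, $I(w)$ the reflections $t$ with $\ell(tw)<\ell(w)$. $\Theta(\vec G)$: smallest lattice congruence of the weak order with $t$ congruent to the element with word $tsts\cdots$ of $m(s,t)-1$ letters for each directed edge $s\to t$ ($m(s_0,s_1)=4$, otherwise 3); $\mathcal C(\vec G)$ is the quotient. Up/down: for $b\in[n-1]$, $b$ is up if $s_b\to s_{b-1}$, down if $s_{b-1}\to s_b$; $n$ is declared up or down arbitrarily; for $b\in[n]$, $-b$ is up iff $b$ is down. A sequence $y_1,\dots,y_{2n}$ (the full notation) contains $\bar{2}31$ if there exist $p<q<r$ with $y_r<y_p<y_q$ and $y_p$ up; otherwise it avoids $\bar{2}31$. *)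

(* Defs.v *)
From mathcomp Require Import all_boot all_order all_fingroup all_algebra.
Set Implicit Arguments. Unset Strict Implicit. Unset Printing Implicit Defensive.
Import GRing.Theory Num.Theory.

Section TypeB.
Variable n : nat.

(* The signed index set ±[n]: (i, false) stands for i+1, (i, true) for -(i+1). *)
Definition T : finType := ('I_n * bool)%type.

Definition sval (c : T) : int :=
  if c.2 then (- Posz c.1.+1)%R else Posz c.1.+1.

Definition negT (c : T) : T := (c.1, ~~ c.2).

Definition signed (x : {perm T}) : bool := [forall c, x (negT c) == negT (x c)].

(* Composition f o g (apply g first). MathComp's product is (p * q) x = q (p x). *)
Definition comp (f g : {perm T}) : {perm T} := (g * f)%g.

Definition prev_ord (j : 'I_n) : 'I_n :=
  Ordinal (leq_ltn_trans (leq_pred j) (ltn_ord j)).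

Definition gen (j : 'I_n) : {perm T} :=
  if j == 0 :> nat then tperm (j, false) (j, true)
  else (tperm (prev_ord j, false) (j, false) * tperm (prev_ord j, true) (j, true))%g.

Definition word_elt (s : seq 'I_n) : {perm T} :=
  foldr (fun j acc => comp (gen j) acc) 1%g s.

Definition reduced_length (w : {perm T}) (k : nat) : Prop :=
  (exists s : seq 'I_n, size s = k /\ word_elt s = w) /\
  (forall s : seq 'I_n, word_elt s = w -> k <= size s).

Definition reflection (t : {perm T}) : Prop :=
  exists (w : {perm T}) (j : 'I_n), signed w /\ t = comp w (comp (gen j) w^-1%g).

Definition inv_set (w t : {perm T}) : Prop :=
  reflection t /\
  exists k1 k2, reduced_length (comp t w) k1 /\ reduced_length w k2 /\ k1 < k2.

Definition weak_le (v w : {perm T}) : Prop := forall t, inv_set v t -> inv_set w t.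

Definition is_meet (x y m : {perm T}) : Prop :=
  signed m /\ weak_le m x /\ weak_le m y /\
  forall z, signed z -> weak_le z x -> weak_le z y -> weak_le z m.

Definition is_join (x y m : {perm T}) : Prop :=
  signed m /\ weak_le x m /\ weak_le y m /\
  forall z, signed z -> weak_le x z -> weak_le y z -> weak_le m z.

Definition lattice_congruence (R : {perm T} -> {perm T} -> Prop) : Prop :=
  (forall x, signed x -> R x x) /\
  (forall x y, R x y -> R y x) /\
  (forall x y z, R x y -> R y z -> R x z) /\
  (forall x y z m1 m2, signed x -> signed y -> signed z -> R x y ->
      is_meet x z m1 -> is_meet y z m2 -> R m1 m2) /\
  (forall x y z m1 m2, signed x -> signed y -> signed z -> R x y ->
      is_join x z m1 -> is_join y z m2 -> R m1 m2).

Variable up : 'I_n -> bool.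
(* up j (index j <-> b = j+1 in [n]) : the value b = j+1 is "up".
   For b in [n-1] (i.e. 0 < j+1 < n, i.e. index j' = b with 0 < j'), the edge
   between s_{b-1} and s_b is oriented s_b -> s_{b-1} iff b is up.
   The value up (index of n) is arbitrary. *)

(* For the edge {s_{b-1}, s_b}, b = j (0 < j), b up iff up (prev_ord j)
   (prev_ord j has value b-1, i.e. is the index of the value b): the generating pair
   (t, t s t ...) with m(s,t)-1 letters, where s -> t. *)
Definition cam_pair (j : 'I_n) : {perm T} * {perm T} :=
  let st :=
    if up (prev_ord j)
    then (gen j, gen (prev_ord j)) else (gen (prev_ord j), gen j) in
  let s := st.1 in let t := st.2 in
  (t, if j == 1 :> nat then comp t (comp s t) else comp t s).

Definition Theta (x y : {perm T}) : Prop :=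
  forall R, lattice_congruence R ->
    (forall j : 'I_n, 0 < j -> R (cam_pair j).1 (cam_pair j).2) -> R x y.

Definition quot_le (x y : {perm T}) : Prop :=
  exists x' y', signed x' /\ signed y' /\ Theta x x' /\ Theta y y' /\ weak_le x' y'.

Definition is_up (c : T) : bool := if c.2 then ~~ up c.1 else up c.1.

(* Full notation y_1..y_{2n} = x(-n),...,x(-1),x(1),...,x(n): position of entry x(c)
   is ordered by sval c. x contains bar2-31 iff p<q<r with y_r < y_p < y_q, y_p up. *)
Definition contains_pattern (x : {perm T}) : Prop :=
  exists a b c : T, (sval a < sval b)%R /\ (sval b < sval c)%R /\
    (sval (x c) < sval (x a))%R /\ (sval (x a) < sval (x b))%R /\ is_up (x a).

Definition avoids (x : {perm T}) : Prop := ~ contains_pattern x.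

End TypeB.

(* Main.v *)
Require Import Defs.
From mathcomp Require Import all_boot all_order all_fingroup all_algebra.
From mathcomp Require Import zify.
Set Implicit Arguments. Unset Strict Implicit. Unset Printing Implicit Defensive.
Import Order.TTheory GRing.Theory Num.Theory.

(** A signed permutation is encoded by its inversion set: the pairs of values a < b with b
    placed before a.  These sets are exactly the biclosed relations invariant under
    (a, b) -> (-b, -a), and the weak order is inclusion.

    Avoiding bar2-31 means that (a, b) inverted and a < c < b force (c, b) to be inverted if c is
    up and (a, c) to be inverted if c is down (for c down, apply the up case to -c).  The largest
    avoiding subset of an inversion set E consists of the (a, b) such that E contains every (c, d)
    with a <= c < d <= b, where c is a or up and d is b or down.  This operator E -> cam E commutes
    with meets and joins, so its fibers are the classes of a congruence, and that congruence
    contains the generating pairs.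

    For the converse, let x have adjacent entries b, a with a < c < b and c up to the left of b,
    and let x' be x with b, a exchanged.  Joining the generating pair indexed by |c| with a
    longest parabolic element gives congruent p <= q; meeting p and q with a suitable v and
    joining with some y >= x' that has a before b shows that y is congruent to an element above
    x; the meet with x then gives that x' and x are congruent. *)

Local Notation sv := Defs.sval.
Local Open Scope ring_scope.

(** * Signed permutations and biclosed relations on their values *)

Section Basics.
Variable n : nat.
Implicit Types (a b c u v : T n) (x y : {perm T n}) (E F : rel (T n)).

Lemma sv_inj : injective (@Defs.sval n).
Proof.
move=> [i s] [j t]; rewrite /Defs.sval /=; case: s; case: t => e; try lia.
- by have -> : i = j by apply: val_inj => /=; lia.
- by have -> : i = j by apply: val_inj => /=; lia.
Qed.

Lemma svN a : sv (negT a) = - sv a.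
Proof. by case: a => i []; rewrite /Defs.sval /= ?opprK. Qed.

Lemma negTK : involutive (@negT n).
Proof. by case=> i s; rewrite /negT /= negbK. Qed.

Lemma sv_bound a : (sv a != 0) && (- n%:Z <= sv a <= n%:Z).
Proof. case: a => i s; have := ltn_ord i; rewrite /Defs.sval /=; case: s; lia. Qed.

Lemma sv_surj (z : int) : z != 0 -> - n%:Z <= z <= n%:Z -> exists a, sv a = z.
Proof.
move=> z0 zn.
have h : (`|z|.-1 < n)%N by lia.
by exists (Ordinal h, z < 0); rewrite /Defs.sval /=; case: ifP; lia.
Qed.

Definition pos x v : int := sv ((x^-1)%g v).

Lemma pos_inj x : injective (pos x).
Proof. by move=> a b /sv_inj /perm_inj. Qed.

Lemma signedP x : reflect (forall c, x (negT c) = negT (x c)) (signed x).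
Proof. by apply: (iffP forallP) => h c; apply/eqP/h. Qed.

Lemma posN x v : signed x -> pos x (negT v) = - pos x v.
Proof.
move=> /signedP sx; rewrite /pos -svN; congr sv.
by apply: (@perm_inj _ x); rewrite permKV sx permKV.
Qed.

Lemma pos_bound x v : (pos x v != 0) && (- n%:Z <= pos x v <= n%:Z).
Proof. exact: sv_bound. Qed.

Definition inverted x a b := (sv a < sv b) && (pos x b < pos x a).

Record biclosed E : Prop := Biclosed {
  bc_lt : forall a b, E a b -> sv a < sv b;
  bc_trans : forall a b c, E a b -> E b c -> E a c;
  bc_cotrans : forall a b c, sv a < sv b -> sv b < sv c -> E a c -> E a b || E b c;
  bc_sym : forall a b, E a b -> E (negT b) (negT a) }.

Lemma inverted_biclosed x : signed x -> biclosed (inverted x).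
Proof.
move=> sx; split; rewrite /inverted.
- by move=> a b /andP[].
- move=> a b c; lia.
- move=> a b c; lia.
- move=> a b; rewrite !posN // !svN; lia.
Qed.

Lemma pos_trichotomy x a b : sv a < sv b -> ~~ inverted x a b -> pos x a < pos x b.
Proof.
rewrite /inverted => ab; rewrite ab /= => h.
have : pos x a != pos x b by apply/eqP => /pos_inj e; move: ab; rewrite e; lia.
lia.
Qed.

Lemma inverted_sub_pos x y : (forall a b, inverted x a b -> inverted y a b) ->
   (forall a b, inverted y a b -> inverted x a b) -> forall a b, pos x a < pos x b -> pos y a < pos y b.
Proof.
move=> xy yx a b ab.
have : sv a != sv b by apply/eqP => /sv_inj e; move: ab; rewrite e; lia.
case: (ltrP (sv a) (sv b)) => [lab _|lba nab].
  by apply: pos_trichotomy => //; apply/negP => /yx; rewrite /inverted; lia.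
by have /xy : inverted x b a by [rewrite /inverted; lia]; rewrite /inverted; lia.
Qed.

Definition rk v := #|[set u : T n | sv u < sv v]|.

Lemma rk_lt a b : sv a < sv b -> (rk a < rk b)%N.
Proof.
move=> ab; apply: proper_card; apply/properP; split.
  by apply/subsetP => u; rewrite !inE; lia.
by exists a; rewrite inE ?ab //; lia.
Qed.

Lemma rk_inj : injective rk.
Proof.
move=> a b e; apply: sv_inj; case: (ltrgtP (sv a) (sv b)) => // /rk_lt; rewrite e; lia.
Qed.

(** The elements below v are carried onto those below the image of v, so ranks are preserved. *)
Lemma increasing_perm_id x : (forall a b, sv a < sv b -> sv (x a) < sv (x b)) -> x = 1%g.
Proof.
move=> inc; apply/permP => v; rewrite perm1; apply: rk_inj.
have mono a b : (sv (x a) < sv (x b)) = (sv a < sv b).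
  apply/idP/idP; last exact: inc.
  case: (ltrgtP (sv a) (sv b)) => // [/inc|/sv_inj ->]; lia.
rewrite /rk -(card_preimset _ (@perm_inj _ x)).
by apply: eq_card => u; rewrite !inE mono.
Qed.

Lemma inverted_inj x y : (forall a b, inverted x a b = inverted y a b) -> x = y.
Proof.
move=> e.
(* This product sends the position of a value in [x] to its position in [y]. Both list the values in
   the same order, so it is increasing. *)
have h : (x * y^-1)%g = 1%g.
  apply: increasing_perm_id => a b ab; rewrite !permM.
  have := @inverted_sub_pos x y _ _ (x a) (x b); rewrite /pos !permK; apply=> //.
  - by move=> ? ?; rewrite e.
  - by move=> ? ?; rewrite e.
by apply/eqP; rewrite -(inj_eq (mulIg y^-1%g)) h mulgV.
Qed.

(** Read: a stands to the left of b in the permutation to be built from [E]. *)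
Definition bef E a b := if sv a < sv b then ~~ E a b else (sv b < sv a) && E b a.

(** Transitivity and cotransitivity of [E] make [bef E] a strict total order, and the permutation
    lists the values in this order. *)
Lemma perm_of_biclosed E : biclosed E -> exists2 x, signed x & forall a b, inverted x a b = E a b.
Proof.
move=> [lt tr ct sy].
have befT a b : sv a != sv b -> bef E a b || bef E b a.
  by rewrite /bef; case: ltrgtP => //= _ _; case: (E _ _).
have befN a b : bef E a b -> ~~ bef E b a.
  by rewrite /bef; case: ltrgtP => //= _; rewrite ?negbK.
have beftr a b c : bef E a b -> bef E b c -> bef E a c.
  rewrite /bef; move: (tr a b c) (tr a c b) (tr b a c) (tr b c a) (tr c a b) (tr c b a).
  move: (ct a b c) (ct a c b) (ct b a c) (ct b c a) (ct c a b) (ct c b a).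
  case: (ltrgtP (sv a) (sv b)) => [ab|ab|/sv_inj ab] //=;
  case: (ltrgtP (sv b) (sv c)) => [bc|bc|/sv_inj bc] //=;
  case: (ltrgtP (sv a) (sv c)) => [ac|ac|/sv_inj ac] //=; subst; try lia.
pose r v := #|[set u : T n | bef E u v]|.
have r_lt a b : bef E a b -> (r a < r b)%N.
  move=> ab; apply: proper_card; apply/properP; split.
    by apply/subsetP => u; rewrite !inE => ua; apply: beftr ab.
  by exists a; rewrite inE ?ab //; rewrite /bef ltxx.
have r_inj : injective r.
  move=> a b e; apply: sv_inj; apply/eqP; apply/negPn/negP => /befT /orP[] /r_lt; rewrite e; lia.
have card_lt (P : pred (T n)) v : ~~ P v -> (#|[set u | P u]| < #|T n|)%N.
  move=> Pv; rewrite -cardsT; apply: proper_card; apply/properP; split; first exact: subsetT.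
  by exists v; rewrite ?inE.
have rkT v : (rk v < #|T n|)%N by apply: (@card_lt _ v); rewrite ltxx.
have rT v : (r v < #|T n|)%N by apply: (@card_lt _ v); rewrite /bef ltxx.
have rk_bij : bijective (fun v => Ordinal (rkT v)).
  by apply: inj_card_bij; [move=> a b [] /rk_inj | rewrite card_ord].
case: rk_bij => g gK Kg.
(* The position of v: the signed index whose rank in the usual order is the rank of v in the order
   [bef E]. *)
pose h v := g (Ordinal (rT v)).
have rkh v : rk (h v) = r v by have := congr1 val (Kg (Ordinal (rT v))).
have h_inj : injective h.
  by move=> a b e; apply: r_inj; rewrite -!rkh e.
pose x := ((perm h_inj)^-1)%g.
have posE v : pos x v = sv (h v) by rewrite /pos invgK permE.
have pos_lt a b : bef E a b -> pos x a < pos x b.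
  rewrite !posE => /r_lt; rewrite -!rkh => rr.
  by case: (ltrgtP (sv (h a)) (sv (h b))) => // [/rk_lt|/sv_inj e]; [lia|move: rr; rewrite e ltnn].
have invE a b : inverted x a b = E a b.
  rewrite /inverted; apply/andP/idP => [[ab]|Eab].
    apply: contraLR => nE; have := @pos_lt a b; rewrite /bef ab => /(_ nE); lia.
  split; first exact: lt.
  by apply: pos_lt; rewrite /bef Eab (lt _ _ Eab) ltNge (ltW (lt _ _ Eab)).
exists x => //; apply/signedP => c.
pose N := perm (inv_inj negTK).
have NE v : N v = negT v by rewrite permE.
(* Conjugating by negation keeps the inversion set, because [E] is invariant under (a, b) -> (-b,
   -a), so it keeps [x]. *)
have xN : x = (N * x * N)%g.
  apply: inverted_inj => a b.
  have posx v : pos (N * x * N)%g v = - pos x (negT v).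
    rewrite /pos -svN; congr sv; apply: (@perm_inj _ (N * x * N)%g).
    by rewrite permKV !permM !NE negTK permKV negTK.
  have Esym : E a b = E (negT b) (negT a) by apply/idP/idP => /sy //; rewrite !negTK.
  by rewrite invE Esym -invE /inverted !posx !svN; lia.
by rewrite {1}xN !permM !NE negTK.
Qed.

End Basics.

(** * Length, reflections, and the weak order as inclusion of inversions *)

Section CoxeterLink.
Variable n : nat.
Implicit Types (a b c u v : T n) (x y w t : {perm T n}) (E F : rel (T n)) (j : 'I_n).

(* The action of s_j on signed integers. *)
Definition gz (j : nat) (z : int) : int :=
  if j == 0%N then (if z == 1 then -1 else if z == -1 then 1 else z)
  else if z == j then j.+1%:Z else if z == j.+1%:Z then j%:Z
  else if z == - j%:Z then - j.+1%:Z else if z == - j.+1%:Z then - j%:Z else z.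

Lemma tpermE a b v : tperm a b v = if sv v == sv a then b else if sv v == sv b then a else v.
Proof. by rewrite permE /= !(inj_eq (@sv_inj n)). Qed.

Lemma sv_gen j v : sv (gen j v) = gz j (sv v).
Proof.
rewrite /gen /gz; have := sv_bound v; case: (eqVneq (j : nat) 0%N) => j0.
  by rewrite tpermE /Defs.sval /= j0; do !case: ifP => /=; lia.
rewrite permM; set p := prev_ord j.
have ep : p.+1 = j :> nat by rewrite /= prednK // lt0n.
have e1 : sv (p, false) = j by rewrite /Defs.sval /= ep.
have e2 : sv (p, true) = - j%:Z by rewrite /Defs.sval /= ep.
have e3 : sv (j, false) = j.+1 by [].
have e4 : sv (j, true) = - j.+1%:Z by [].
by rewrite !tpermE; do !case: ifP; rewrite ?e1 ?e2 ?e3 ?e4; lia.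
Qed.

Lemma gzN (j : nat) z : gz j (- z) = - gz j z.
Proof. by rewrite /gz; do !case: ifP; lia. Qed.

Lemma gzK (j : nat) : involutive (gz j).
Proof. by move=> z; rewrite /gz; do !case: ifP; rewrite ?eqxx; lia. Qed.

Lemma compE (f g : {perm T n}) v : Defs.comp f g v = f (g v).
Proof. by rewrite /Defs.comp permM. Qed.

Lemma genK j : involutive (gen j).
Proof. by move=> v; apply: sv_inj; rewrite !sv_gen gzK. Qed.

Lemma genV j : (gen j)^-1%g = gen j.
Proof. by apply/permP => v; apply: (@perm_inj _ (gen j)); rewrite permKV genK. Qed.

Lemma signed_gen j : signed (gen j).
Proof. by apply/signedP => c; apply: sv_inj; rewrite svN !sv_gen svN gzN. Qed.

Lemma signed_comp x y : signed x -> signed y -> signed (Defs.comp x y).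
Proof. by move=> /signedP sx /signedP sy; apply/signedP => c; rewrite !compE sy sx. Qed.

Lemma signed1 : signed (1%g : {perm T n}).
Proof. by apply/signedP => c; rewrite !perm1. Qed.

Lemma signed_word s : signed (word_elt s : {perm T n}).
Proof. by elim: s => [|j s IH]; [exact: signed1 | apply: signed_comp; rewrite ?signed_gen]. Qed.

Lemma pos_comp t w v : pos (Defs.comp t w) v = pos w ((t^-1)%g v).
Proof. by rewrite /pos /Defs.comp invMg permM. Qed.

Lemma pos_gen_comp j w v : pos (Defs.comp (gen j) w) v = pos w (gen j v).
Proof. by rewrite pos_comp genV. Qed.

Definition flips (j : nat) a b := (sv a < sv b) && (gz j (sv b) < gz j (sv a)).

Lemma flipsP (j : nat) a b : flips j a b ->
  [\/ j = 0%N /\ (sv a = -1 /\ sv b = 1),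
      (0 < j)%N /\ (sv a = j /\ sv b = j.+1) |
      (0 < j)%N /\ (sv a = - j.+1%:Z /\ sv b = - j%:Z)].
Proof.
move=> /andP[]; have := sv_bound a; have := sv_bound b; rewrite /gz.
case: (eqVneq j 0%N) => j0.
  by do !case: ifP => ?; move=> *; apply: Or31; lia.
by do !case: ifP => ?; move=> *; (apply: Or32; lia) || (apply: Or33; lia) || lia.
Qed.

Lemma flipsI (j : nat) a b :
  (j = 0%N /\ sv a = -1 /\ sv b = 1) \/
  (0 < j)%N /\ (sv a = j /\ sv b = j.+1 \/ sv a = - j.+1%:Z /\ sv b = - j%:Z) -> flips j a b.
Proof.
by rewrite /flips /gz => -[[-> [-> ->]]|[j0 [[-> ->]|[-> ->]]]] //; do !case: ifP; rewrite ?eqxx; lia.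
Qed.

Lemma flips_eq (j : nat) a b : flips j a b ->
  gz j (sv a) = sv b /\ gz j (sv b) = sv a.
Proof.
by move=> /flipsP[] [j0 [-> ->]]; rewrite /gz; split; do !case: ifP; lia.
Qed.

Lemma flips_flips (j : nat) a b u v : flips j a b -> flips j u v ->
  (u = a /\ v = b) \/ (u = negT b /\ v = negT a).
Proof.
move=> ab uv.
have : (sv u = sv a /\ sv v = sv b) \/ (sv u = sv (negT b) /\ sv v = sv (negT a)).
  by rewrite !svN; case/flipsP: ab => -[? ?]; case/flipsP: uv => -[? ?]; lia.
by case=> -[/sv_inj -> /sv_inj ->]; [left|right].
Qed.

(** The reflection exchanging a with b and -a with -b. When b = -a the two transpositions coincide
    and would cancel, so only one is taken. *)
Definition rf a b : {perm T n} :=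
  if b == negT a then tperm a b else (tperm a b * tperm (negT a) (negT b))%g.

Lemma rfE a b v : sv a != sv b -> sv (rf a b v) =
  if sv v == sv a then sv b else if sv v == sv b then sv a
  else if sv v == - sv a then - sv b else if sv v == - sv b then - sv a else sv v.
Proof.
rewrite /rf -(inj_eq (@sv_inj n)) svN; case: ifP => h.
  by rewrite tpermE; do !case: ifP; lia.
rewrite permM !tpermE.
have := sv_bound a; have := sv_bound b; have := sv_bound v.
by rewrite !svN; do !case: ifP; do ?rewrite svN; lia.
Qed.

Lemma rfC a b : sv a != sv b -> rf a b = rf b a.
Proof.
move=> h; apply/permP => v; apply: sv_inj; rewrite !rfE //; last by rewrite eq_sym.
by do !case: ifP; lia.
Qed.

Lemma rfK a b : sv a != sv b -> (rf a b)^-1%g = rf a b.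
Proof.
move=> h; apply/permP => v; apply: (@perm_inj _ (rf a b)); rewrite permKV.
have := sv_bound a; have := sv_bound b => ? ?.
by apply: sv_inj; rewrite !rfE //; do !case: ifP; rewrite ?eqxx; lia.
Qed.

Lemma rf_conj w a b : signed w -> Defs.comp w (Defs.comp (rf a b) w^-1%g) = rf (w a) (w b).
Proof.
move=> /signedP sw; rewrite /Defs.comp -mulgA -/(conjg (rf a b) w) /rf -sw (inj_eq perm_inj).
by case: ifP => _; rewrite ?conjMg !tpermJ // !sw.
Qed.

Lemma gen_rf j a b : flips j a b -> rf a b = gen j.
Proof.
move=> f; apply/permP => v; apply: sv_inj; rewrite sv_gen rfE.
  have := sv_bound v => hv.
  by case/flipsP: f => -[j0 [-> ->]]; rewrite /gz; do !case: ifP; lia.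
by case/andP: f; lia.
Qed.

Lemma rf_gen j a b : rf (gen j a) (gen j b) = Defs.comp (gen j) (Defs.comp (rf a b) (gen j)).
Proof. by rewrite -(rf_conj _ _ (signed_gen j)) genV. Qed.

Lemma gen_compK j w : Defs.comp (gen j) (Defs.comp (gen j) w) = w.
Proof. by apply/permP => v; rewrite !compE genK. Qed.

Lemma compA x y w : Defs.comp (Defs.comp x y) w = Defs.comp x (Defs.comp y w).
Proof. by apply/permP => v; rewrite !compE. Qed.

(** Consecutive values are -1, 1 or have the same sign; the index j is one less than the larger
    absolute value. *)
Lemma ex_flips a b : sv a < sv b -> (forall u, sv a < sv u -> sv b <= sv u) ->
  exists j, flips j a b.
Proof.
move=> ab adj; have := sv_bound a; have := sv_bound b => hb ha.
have step (z : int) : z != 0 -> sv a < z -> z <= n -> sv b <= z.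
  by move=> z0 az zn; case: (@sv_surj n z z0) => [|u eu]; [lia | rewrite -eu; apply: adj; lia].
have s1 := step (-1); have s2 := step (sv b - 1); have s3 := step (sv a + 1).
case: (ltrP 0 (sv b)) => b0.
  have eb : sv b = b.1.+1%:Z by move: b0; rewrite /Defs.sval; case: (b.2); lia.
  by exists b.1; apply: flipsI; lia.
have ea : sv a = - a.1.+1%:Z by move: ab b0; rewrite /Defs.sval; case: (a.2); lia.
by exists a.1; apply: flipsI; lia.
Qed.

Lemma reflection_conj j t : reflection t -> reflection (Defs.comp (gen j) (Defs.comp t (gen j))).
Proof.
case=> w [i [sw ->]]; exists (Defs.comp (gen j) w), i; split.
  by rewrite signed_comp ?signed_gen.
apply/permP => v; rewrite !compE.
have -> : ((Defs.comp (gen j) w)^-1)%g = Defs.comp (w^-1)%g (gen j).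
  by rewrite /Defs.comp invMg genV.
by rewrite !compE.
Qed.

Lemma reflection_gen j : reflection (gen j).
Proof.
exists 1%g, j; split; first exact: signed1.
by apply/permP => v; rewrite !compE invg1 !perm1.
Qed.

(* Strong exchange: s' is s with one letter deleted. *)
Lemma exchange s a b : inverted (word_elt s) a b ->
  reflection (rf a b) /\
  exists2 s', (size s' < size s)%N & word_elt s' = Defs.comp (rf a b) (word_elt s).
Proof.
elim: s a b => [|j s IH] a b.
  by rewrite /inverted /= /pos invg1 !perm1; lia.
rewrite [word_elt _]/= => iab.
(* Either the reflection is the first letter, which is then deleted, or the pair carried through
   [gen j] is an inversion of the rest of the word and induction deletes a letter there. *)
case: (boolP (flips j a b)) => [f|nf].
  by rewrite (gen_rf f); split; [exact: reflection_gen | exists s; rewrite //= gen_compK].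
have /IH [r [s' ss' es']] : inverted (word_elt s) (gen j a) (gen j b).
  move: iab nf; rewrite /inverted /flips !pos_gen_comp !sv_gen.
  have : gz j (sv a) = gz j (sv b) -> sv a = sv b by move/(can_inj (gzK j)).
  by lia.
rewrite -[a in rf a](genK j) -[b in rf _ b](genK j) rf_gen; split; first exact: reflection_conj.
by exists (j :: s') => //=; rewrite es' !compA gen_compK.
Qed.

(** An inversion with a value strictly between its ends yields a closer inversion by cotransitivity,
    so a closest one would consist of consecutive values. *)
Lemma no_flip_inverted w : (forall j a b, flips j a b -> ~~ inverted w a b) ->
  signed w -> w = 1%g.
Proof.
move=> h sw; apply: inverted_inj => a b; rewrite [RHS]/inverted /pos invg1 !perm1.
suff -> : inverted w a b = false by lia.
have [k] := ubnP `|sv b - sv a|; elim: k a b => // k IH a b ab.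
apply/negP => i; have [iab _ ] := andP i.
have [/existsP[u /andP[au ub]]|/existsPn nu] := boolP [exists u : T n, (sv a < sv u) && (sv u < sv b)].
  have := bc_cotrans (inverted_biclosed sw) au ub i.
  by rewrite !IH //; lia.
have [j /h] : exists j, flips j a b.
  by apply: ex_flips => // u au; have := nu u; rewrite au; lia.
by rewrite i.
Qed.

Lemma word_exists w : signed w -> exists s, word_elt s = w.
Proof.
have [k] := ubnP #|[set p : T n * T n | inverted w p.1 p.2]|.
elim: k w => // k IH w wk sw.
case: (boolP [exists j : 'I_n, exists a, exists b, flips j a b && inverted w a b]); last first.
  move=> H; exists [::]; rewrite /= [RHS]no_flip_inverted // => j a b f.
  by apply/negP => i; case/negP: H; apply/existsP; exists j; apply/existsP; exists a;
    apply/existsP; exists b; rewrite f.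
move=> /existsP[j /existsP[a /existsP[b /andP[f i]]]].
have [||s es] := IH (Defs.comp (gen j) w); last by exists (j :: s); rewrite /= es gen_compK.
  2: by rewrite signed_comp ?signed_gen.
rewrite ltnS in wk; apply: leq_trans wk.
(* [g] injects the inversions of s_j w into those of w and misses (a, b), so the number of
   inversions drops. *)
pose g (p : T n * T n) := (gen j p.1, gen j p.2).
have g_inj : injective g by move=> [p q] [r s] [] /perm_inj -> /perm_inj ->.
rewrite -(card_imset _ g_inj); apply: proper_card; apply/properP; split; last first.
  exists (a, b); rewrite ?inE //=; apply/negP => /imsetP[[u v]]; rewrite inE /= => iuv [ea eb].
  have [e1 e2] := flips_eq f; case/andP: f => ab _; case/andP: iuv => uv _.
  have : sv u = sv b by rewrite -(genK j u) -ea sv_gen.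
  have : sv v = sv a by rewrite -(genK j v) -eb sv_gen.
  by lia.
apply/subsetP => _ /imsetP[[u v] + ->]; rewrite !inE /= => iuv.
case: (boolP (flips j u v)) => [f'|nf]; last first.
  move: iuv nf; rewrite /inverted /flips !pos_gen_comp !sv_gen.
  have : gz j (sv u) = gz j (sv v) -> sv u = sv v by move/(can_inj (gzK j)).
  by lia.
have iuv' : inverted w u v.
  by case: (flips_flips f f') => -[-> ->] //; apply: bc_sym i; apply: inverted_biclosed.
have [eu ev] := flips_eq f'.
have eu' : gen j u = v by apply: sv_inj; rewrite sv_gen.
have ev' : gen j v = u by apply: sv_inj; rewrite sv_gen.
by move: iuv iuv'; rewrite /inverted !pos_gen_comp eu' ev'; lia.
Qed.

Lemma reduced_length_exists w : signed w -> exists k, reduced_length w k.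
Proof.
move=> /word_exists [s0 es0].
pose P k := [exists s : k.-tuple 'I_n, word_elt s == w].
have exP : exists k, P k by exists (size s0); apply/existsP; exists (in_tuple s0); rewrite /= es0.
case: (ex_minnP exP) => k /existsP[s /eqP es] min.
exists k; split; first by exists s; rewrite size_tuple.
by move=> s' es'; apply: min; apply/existsP; exists (in_tuple s'); rewrite /= es'.
Qed.

(** For an inversion, strong exchange shortens w. For a non-inversion, (a, b) is an inversion of the
    product of [rf a b] and w, and exchange applied to that product shows that w is the shorter
    one. *)
Lemma inv_setP w a b : signed w -> sv a < sv b -> (inv_set w (rf a b) <-> inverted w a b).
Proof.
move=> sw ab; have ab' : sv a != sv b by lia.
have rfl : rf a b a = b by apply: sv_inj; rewrite rfE // eqxx.
have rfr : rf a b b = a by apply: sv_inj; rewrite rfE // eqxx eq_sym (negbTE ab').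
have rfrf x : Defs.comp (rf a b) (Defs.comp (rf a b) x) = x.
  by apply/permP => v; rewrite !compE -{1}(rfK ab') permK.
split=> [[_ [k1 [k2 [[[s1 [z1 e1]] _] [[_ min2] k12]]]]]|i].
  apply: contraTT k12 => ni; rewrite -leqNgt -z1.
  have /exchange [_ [s' ss' es']] : inverted (word_elt s1) a b.
    move: ni; rewrite e1 /inverted ab !pos_comp rfK // rfl rfr /= => ni.
    by apply: pos_trichotomy => //; rewrite /inverted ab.
  by apply: leq_trans (ltnW ss'); apply: min2; rewrite es' e1 rfrf.
have [k2 rk2] := reduced_length_exists sw.
have [[s2 [z2 e2]] min2] := rk2.
move: (i); rewrite -{1}e2 => /exchange [refl [s' ss' es']].
split=> //.
have [|k1 rk1] := @reduced_length_exists (Defs.comp (rf a b) w).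
  by rewrite -e2 -es' signed_word.
exists k1, k2; split=> //; split=> //; rewrite -z2; apply: leq_ltn_trans ss'.
by case: rk1 => _; apply; rewrite es' e2.
Qed.

Lemma reflection_rf t : reflection t -> exists a b, sv a < sv b /\ t = rf a b.
Proof.
case=> w [j [sw ->]].
suff [a [b [ab ->]]] : exists a b, sv a != sv b /\ gen j = rf a b.
  rewrite rf_conj //.
  have : sv (w a) != sv (w b) by apply: contraNneq ab => /sv_inj /perm_inj ->.
  by case: ltrgtP => // h _; [exists (w a), (w b) | exists (w b), (w a); rewrite -rfC //; lia].
have hj := ltn_ord j.
have [||b eb] := @sv_surj n j.+1%:Z; try lia.
have [||a ea] := @sv_surj n (if j == 0%N :> nat then -1 else j%:Z); try by case: ifP; lia.
exists a, b; split; first by rewrite ea eb; case: ifP; lia.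
by rewrite (@gen_rf j) //; apply: flipsI; move: ea; case: ifP; lia.
Qed.

Lemma weak_leP x y : signed x -> signed y ->
  (weak_le x y <-> forall a b, inverted x a b -> inverted y a b).
Proof.
move=> sx sy; split=> [xy a b i|xy t it].
  have ab : sv a < sv b by case/andP: i.
  by apply/(inv_setP sy ab)/xy/(inv_setP sx ab).
have [a [b [ab et]]] := reflection_rf it.1.
by rewrite et in it *; apply/(inv_setP sy ab)/xy/(inv_setP sx ab).
Qed.

End CoxeterLink.

(** * Joins and meets of biclosed relations *)

Section Lattice.
Variable n : nat.
Implicit Types (a b c d u v : T n) (x y z m : {perm T n}) (E F G : rel (T n)) (j : 'I_n).

Definition relU E F : rel (T n) := fun u v => E u v || F u v.

(** The transitive closure of the union. Since [connect] is reflexive, the inequality on values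
    removes the diagonal. *)
Definition joinr E F : rel (T n) := fun u v => (sv u < sv v) && connect (relU E F) u v.

Definition compl E : rel (T n) := fun u v => (sv u < sv v) && ~~ E u v.

(** Complementation reverses inclusion of biclosed relations, so it turns joins into meets. *)
Definition meetr E F := compl (joinr (compl E) (compl F)).

Lemma compl_biclosed E : biclosed E -> biclosed (compl E).
Proof.
case=> lt tr ct sy; split; rewrite /compl.
- by move=> a b /andP[].
- by move=> a b c /andP[ab /negP nab] /andP[bc /negP nbc]; have := ct a b c ab bc; lia.
- by move=> a b c ab bc; have := tr a b c; lia.
- by move=> a b; rewrite !svN; have := sy (negT b) (negT a); rewrite !negTK; lia.
Qed.

Lemma connect_closed (I : T n -> Prop) (e : rel (T n)) a b :
  (forall u v, e u v -> I u -> I v) -> connect e a b -> I a -> I b.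
Proof.
move=> cl /connectP[p]; elim: p a => [|u p IH] a /=; first by move=> _ ->.
by case/andP=> eau pu lb Ia; apply: IH pu lb (cl _ _ eau Ia).
Qed.

Lemma joinr_closed (I : T n -> Prop) E F a b :
  (forall u v, E u v -> I u -> I v) -> (forall u v, F u v -> I u -> I v) ->
  joinr E F a b -> I a -> I b.
Proof.
move=> cE cF /andP[_]; apply: connect_closed => u v /orP[]; [exact: cE|exact: cF].
Qed.

Lemma joinr_l E F a b : biclosed E -> E a b -> joinr E F a b.
Proof. by move=> bE Eab; rewrite /joinr (bc_lt bE Eab) connect1 // /relU Eab. Qed.

Lemma joinr_r E F a b : biclosed F -> F a b -> joinr E F a b.
Proof. by move=> bF Fab; rewrite /joinr (bc_lt bF Fab) connect1 // /relU Fab orbT. Qed.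

Lemma joinr_min E F G a b : (forall u v (w : T n), G u v -> G v w -> G u w) ->
  (forall u v, E u v -> G u v) -> (forall u v, F u v -> G u v) -> joinr E F a b -> G a b.
Proof.
move=> trG EG FG jab; case/andP: (jab) => ab _.
suff : b = a \/ G a b by case=> // e; move: ab; rewrite e; lia.
apply: (joinr_closed (I := fun v => v = a \/ G a v) _ _ jab); last by left.
- by move=> u v /EG Guv [<-|Gau]; right=> //; apply: trG Guv.
- by move=> u v /FG Guv [<-|Gau]; right=> //; apply: trG Guv.
Qed.

(** The chain either visits b or has a step passing over b, and that step splits at b. *)
Lemma connect_cotrans (e : rel (T n)) a b c :
  (forall u v (w : T n), sv u < sv v -> sv v < sv w -> e u w -> e u v || e v w) ->
  connect e a c -> sv a < sv b -> sv b < sv c -> connect e a b || connect e b c.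
Proof.
move=> ct /connectP[p]; elim: p a => [|u p IH] a /=; first by move=> _ ->; lia.
case/andP=> eau pu lc ab bc.
case: (ltrgtP (sv b) (sv u)) => [bu|ub|/sv_inj ->]; last by rewrite connect1.
  case/orP: (ct _ _ _ ab bu eau) => e1; first by rewrite connect1.
  by apply/orP; right; apply: connect_trans (connect1 e1) _; apply/connectP; exists p.
case/orP: (IH _ pu lc ub bc) => [h|->]; last by rewrite orbT.
by rewrite (connect_trans (connect1 eau) h).
Qed.

Lemma joinr_biclosed E F : biclosed E -> biclosed F -> biclosed (joinr E F).
Proof.
move=> bE bF; split.
- by move=> a b /andP[].
- move=> a b c /andP[ab Cab] /andP[bc Cbc]; rewrite /joinr (connect_trans Cab Cbc) andbT.
  exact: lt_trans bc.
- move=> a b c ab bc /andP[ac Cac]; rewrite /joinr ab bc /=.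
  apply: connect_cotrans Cac ab bc => u v w uv vw /orP[] e.
    by rewrite /relU; case/orP: (bc_cotrans bE uv vw e) => ->; rewrite ?orbT.
  by rewrite /relU; case/orP: (bc_cotrans bF uv vw e) => ->; rewrite ?orbT.
- move=> a b /andP[ab C]; rewrite /joinr !svN ltrN2 ab /=.
  apply: (connect_closed (I := fun v => connect _ (negT v) (negT a)) _ C) => // u v e h.
  apply: connect_trans h; apply: connect1.
  by rewrite /relU; case/orP: e => [/(bc_sym bE)|/(bc_sym bF)] ->; rewrite ?orbT.
Qed.

Lemma meetr_biclosed E F : biclosed E -> biclosed F -> biclosed (meetr E F).
Proof. by move=> bE bF; apply/compl_biclosed/joinr_biclosed; exact: compl_biclosed. Qed.

Lemma meetr_sub E F a b : biclosed E -> biclosed F -> meetr E F a b -> E a b /\ F a b.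
Proof.
move=> bE bF /andP[ab nj]; split; apply: contraNT nj => h.
  by apply: joinr_l; [exact: compl_biclosed | rewrite /compl ab].
by apply: joinr_r; [exact: compl_biclosed | rewrite /compl ab].
Qed.

Lemma meetr_max E F G a b : biclosed G ->
  (forall u v, G u v -> E u v) -> (forall u v, G u v -> F u v) -> G a b -> meetr E F a b.
Proof.
move=> bG GE GF Gab; rewrite /meetr /compl (bc_lt bG Gab) /=; apply/negP => j.
suff : compl G a b by rewrite /compl Gab andbF.
apply: joinr_min j; first by apply: bc_trans; exact: compl_biclosed.
- by move=> u v /andP[uv h]; rewrite /compl uv; apply: contraNN h; exact: GE.
- by move=> u v /andP[uv h]; rewrite /compl uv; apply: contraNN h; exact: GF.
Qed.

(** The tool for showing that a pair lies in a meet: a set containing a but not b, which no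
    non-inversion of [E] or [F] leaves, excludes every chain of non-inversions from a to b. *)
Lemma meetr_closed (I : T n -> Prop) E F a b : sv a < sv b -> 
  (forall u v, sv u < sv v -> ~~ E u v -> I u -> I v) ->
  (forall u v, sv u < sv v -> ~~ F u v -> I u -> I v) -> I a -> ~ I b -> meetr E F a b.
Proof.
move=> ab cE cF Ia Ib; rewrite /meetr /compl ab; apply/negP => j; apply: Ib.
by apply: joinr_closed j Ia => u v /andP[]; [exact: cE | exact: cF].
Qed.

Lemma join_exists x y : signed x -> signed y -> exists m, is_join x y m /\
  forall a b, inverted m a b = joinr (inverted x) (inverted y) a b.
Proof.
move=> sx sy; have bx := inverted_biclosed sx; have b_y := inverted_biclosed sy.
have [m sm em] := perm_of_biclosed (joinr_biclosed bx b_y).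
exists m; split=> //; split=> //; split; [|split].
- by apply/(weak_leP sx sm) => a b; rewrite em; apply: joinr_l.
- by apply/(weak_leP sy sm) => a b; rewrite em; apply: joinr_r.
- move=> z sz /(weak_leP sx sz) xz /(weak_leP sy sz) yz; apply/(weak_leP sm sz) => a b.
  by rewrite em; apply: joinr_min => //; apply: bc_trans; exact: inverted_biclosed.
Qed.

Lemma meet_exists x y : signed x -> signed y -> exists m, is_meet x y m /\
  forall a b, inverted m a b = meetr (inverted x) (inverted y) a b.
Proof.
move=> sx sy; have bx := inverted_biclosed sx; have b_y := inverted_biclosed sy.
have [m sm em] := perm_of_biclosed (meetr_biclosed bx b_y).
exists m; split=> //; split=> //; split; [|split].
- by apply/(weak_leP sm sx) => a b; rewrite em => /(meetr_sub bx b_y)[].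
- by apply/(weak_leP sm sy) => a b; rewrite em => /(meetr_sub bx b_y)[].
- move=> z sz /(weak_leP sz sx) zx /(weak_leP sz sy) zy; apply/(weak_leP sz sm) => a b.
  by rewrite em; apply: meetr_max => //; exact: inverted_biclosed.
Qed.

Lemma weak_le_anti x y : signed x -> signed y -> weak_le x y -> weak_le y x -> x = y.
Proof.
move=> sx sy /(weak_leP sx sy) xy /(weak_leP sy sx) yx; apply: inverted_inj => a b.
by apply/idP/idP; [exact: xy | exact: yx].
Qed.

Lemma is_joinE x y m : signed x -> signed y -> is_join x y m ->
  forall a b, inverted m a b = joinr (inverted x) (inverted y) a b.
Proof.
move=> sx sy [sm [xm [ym mmin]]]; have [m' [[sm' [xm' [ym' min']]] e]] := join_exists sx sy.
by move=> a b; rewrite -e; congr (inverted _ _ _); apply: weak_le_anti; auto.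
Qed.

Lemma is_meetE x y m : signed x -> signed y -> is_meet x y m ->
  forall a b, inverted m a b = meetr (inverted x) (inverted y) a b.
Proof.
move=> sx sy [sm [xm [ym mmin]]]; have [m' [[sm' [xm' [ym' min']]] e]] := meet_exists sx sy.
by move=> a b; rewrite -e; congr (inverted _ _ _); apply: weak_le_anti; auto.
Qed.

Lemma joinr_congr E E' F F' a b : (forall u v, E u v = E' u v) -> (forall u v, F u v = F' u v) ->
  joinr E F a b = joinr E' F' a b.
Proof. by move=> eE eF; congr andb; apply: eq_connect => u v; rewrite /relU eE eF. Qed.

End Lattice.

(** * The operator [cam] and the congruence given by its fibers *)

Section Cambrian.
Variables (n : nat) (up : 'I_n -> bool).
Implicit Types (a b c d u v : T n) (x y z m : {perm T n}) (E F G : rel (T n)) (j : 'I_n).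

Lemma is_upN c : is_up up (negT c) = ~~ is_up up c.
Proof. by case: c => i [] //=; rewrite /is_up /= negbK. Qed.

Definition cam E : rel (T n) := fun a b =>
  (sv a < sv b) && [forall c, forall d,
     [&& sv a <= sv c, sv c < sv d, sv d <= sv b, (c == a) || is_up up c
       & (d == b) || ~~ is_up up d] ==> E c d].

Lemma camP E a b : reflect (sv a < sv b /\ forall c d, sv a <= sv c -> sv c < sv d ->
   sv d <= sv b -> c = a \/ is_up up c -> d = b \/ ~~ is_up up d -> E c d) (cam E a b).
Proof.
apply: (iffP andP) => -[ab h]; split=> //.
  move=> c d ac cd db hc hd; move/forallP/(_ c)/forallP/(_ d)/implyP: h; apply.
  rewrite ac cd db /=; apply/andP; split.
    by case: hc => [->|->]; rewrite ?eqxx ?orbT.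
  by case: hd => [->|->]; rewrite ?eqxx ?orbT.
apply/forallP => c; apply/forallP => d; apply/implyP => /and5P[ac cd db hc hd].
apply: h => //; first by case/orP: hc => [/eqP|]; [left|right].
by case/orP: hd => [/eqP|]; [left|right].
Qed.

Definition avoiding E := forall a b c, E a b -> sv a < sv c -> sv c < sv b ->
  if is_up up c then E c b else E a c.

Lemma cam_sub E a b : cam E a b -> E a b.
Proof. by case/camP=> ab; apply=> //; left. Qed.

Lemma cam_avoiding E : avoiding (cam E).
Proof.
move=> a b c /camP[ab h] ac cb; case: ifP => uc; apply/camP; split=> // u v.
- move=> cu uv vb hu hv; apply: h => //; first exact: le_trans (ltW ac) cu.
  by case: hu => [->|]; right.
- move=> au uv vc hu hv; apply: h => //; first exact: le_trans vc (ltW cb).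
  by case: hv => [->|]; right; rewrite ?uc.
Qed.

Lemma cam_mono E F a b : (forall u v, E u v -> F u v) -> cam E a b -> cam F a b.
Proof. by move=> EF /camP[ab h]; apply/camP; split=> // c d *; apply/EF/h. Qed.

(** Avoidance of [F] first moves the lower end a to an up value c, then the upper end b to a down
    value d, which reaches every pair demanded by [cam]. *)
Lemma cam_max E F a b : (forall u v, F u v -> sv u < sv v) -> avoiding F ->
  (forall u v, F u v -> E u v) -> F a b -> cam E a b.
Proof.
move=> lt av FE Fab; apply/camP; split=> [|c d ac cd db hc hd]; first exact: lt.
apply: FE.
have Fcb : F c b.
  case: hc => [->//|uc]; case: (ltrgtP (sv a) (sv c)) ac => // [ac|/sv_inj <- //] _.
  by have := av _ _ _ Fab ac (lt_le_trans cd db); rewrite uc.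
case: hd => [->//|ud]; case: (ltrgtP (sv d) (sv b)) db => // [db|/sv_inj -> //] _.
by have := av _ _ _ Fcb cd db; rewrite (negbTE ud).
Qed.

(** For transitivity, a demanded pair lies below b, lies above b, or is cut at b. Cotransitivity
    follows from avoidance alone. *)
Lemma cam_biclosed E : biclosed E -> biclosed (cam E).
Proof.
move=> bE; split.
- by move=> a b /camP[].
- move=> a b c /camP[ab hab] /camP[bc hbc]; apply/camP; split; first exact: lt_trans bc.
  move=> u v au uv vc hu hv.
  case: (lerP (sv v) (sv b)) => [vb|bv].
    apply: hab => //; case: hv => [ev|]; last by right.
    by left; apply: sv_inj; move: vb; rewrite ev; lia.
  case: (lerP (sv b) (sv u)) => [bu|ub].
    apply: hbc => //; case: hu => [eu|]; last by right.
    by left; apply: sv_inj; move: bu; rewrite eu; lia.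
  apply: (bc_trans bE (b := b)); first by apply: hab => //; left.
  by apply: hbc => //; left.
- by move=> a b c ab bc /cam_avoiding /(_ ab bc); case: ifP => _ ->; rewrite ?orbT.
- move=> a b /camP[ab h]; apply/camP; split; first by rewrite !svN; lia.
  move=> c d; rewrite !svN => bc cd da hc hd.
  rewrite -[c]negTK -[d]negTK; apply: bc_sym => //; apply: h; rewrite ?svN; try lia.
    by case: hd => [->|h]; [left; rewrite negTK | right; rewrite is_upN].
  by case: hc => [->|h]; [left; rewrite negTK | right; rewrite is_upN negbK].
Qed.

Lemma cam_id E a b : biclosed E -> avoiding E -> cam E a b = E a b.
Proof.
by move=> bE av; apply/idP/idP; [exact: cam_sub | apply: cam_max => //; apply: bc_lt].
Qed.

(** Whether c is up or down alone decides on which side of c an avoiding relation splits. Hence the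
    intersection of two avoiding biclosed relations is again biclosed, and lies below the meet. *)
Lemma cam_meetr E F a b : biclosed E -> biclosed F ->
  cam (meetr E F) a b = cam E a b && cam F a b.
Proof.
move=> bE bF; apply/idP/andP => [h|[hE hF]].
  by split; apply: cam_mono h => u v /(meetr_sub bE bF)[].
have [bcE bcF] := (cam_biclosed bE, cam_biclosed bF).
pose G : rel (T n) := fun u v => cam E u v && cam F u v.
have avG : avoiding G.
  move=> u v w /andP[/cam_avoiding hE' /cam_avoiding hF'] uw wv.
  by have := hE' _ uw wv; have := hF' _ uw wv; rewrite /G; case: ifP => _ -> ->.
have bG : biclosed G.
  split.
  - by move=> u v /andP[/(bc_lt bcE)].
  - move=> u v w /andP[E1 F1] /andP[E2 F2].
    by rewrite /G (bc_trans bcE E1 E2) (bc_trans bcF F1 F2).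
  - by move=> u v w uv vw /avG /(_ uv vw); case: ifP => _ ->; rewrite ?orbT.
  - by move=> u v /andP[/(bc_sym bcE) E1 /(bc_sym bcF) F1]; rewrite /G E1.
apply: (cam_max (F := G)) => //; last by rewrite /G hE hF.
- exact: bc_lt bG.
- move=> u v Guv; apply: (meetr_max bG) Guv => w t /andP[] => [/cam_sub //|_ /cam_sub //].
Qed.

(** Avoidance applies to the step of the chain that passes c; its upper part continues to b when c
    is up, its lower part completes a chain from a when c is down. *)
Lemma joinr_avoiding E F : avoiding E -> avoiding F ->
  (forall u v, E u v -> sv u < sv v) -> (forall u v, F u v -> sv u < sv v) ->
  avoiding (joinr E F).
Proof.
move=> aE aF lE lF a b c /andP[ab]; rewrite /joinr => /connectP[p].
elim: p a ab => [|u p IH] a ab /=; first by move=> _ ->; lia.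
case/andP=> eau pu lb ac cb.
have lau : sv a < sv u by case/orP: eau => [/lE|/lF].
have avu : sv c < sv u -> if is_up up c then E c u || F c u else E a c || F a c.
  move=> cu; case/orP: eau => [/aE|/aF] /(_ c ac cu); case: ifP => _ ->; rewrite ?orbT //.
have Cub : connect (relU E F) u b by apply/connectP; exists p.
case: (ltrgtP (sv c) (sv u)) => [cu|uc|/sv_inj ecu].
- move: (avu cu); rewrite ac cb; case: ifP => _ e /=; last exact: connect1.
  by apply: connect_trans Cub; exact: connect1.
- have ub : sv u < sv b by lia.
  move: (IH u ub pu lb uc cb); rewrite ac cb uc; case: ifP => _ //= h.
  exact: connect_trans (connect1 eau) h.
- by rewrite ac cb ecu; case: ifP => _ //=; exact: connect1.
Qed.

(* Induction on b - a.  If no up m splits (a, b) with (a, m) in cam C, and dually for down m,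
   then C contains no (a, m) with m up and no (m, b) with m down, so (a, b) lies already
   in E or in F, and cotransitivity puts all pairs required by cam there as well. *)
Lemma cam_joinr E F a b : biclosed E -> biclosed F ->
  cam (joinr E F) a b = joinr (cam E) (cam F) a b.
Proof.
move=> bE bF; have [bcE bcF] := (cam_biclosed bE, cam_biclosed bF).
apply/idP/idP; last first.
  apply: cam_max.
  - by move=> u v /andP[].
  - exact: (joinr_avoiding (@cam_avoiding E) (@cam_avoiding F) (bc_lt bcE) (bc_lt bcF)).
  - move=> u v; apply: joinr_min; first by apply: bc_trans; exact: joinr_biclosed.
    + by move=> ? ? /cam_sub; exact: joinr_l.
    + by move=> ? ? /cam_sub; exact: joinr_r.
set C := joinr E F.
have bC : biclosed C by exact: joinr_biclosed.
have bJ : biclosed (joinr (cam E) (cam F)) by exact: joinr_biclosed.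
have [k] := ubnP `|sv b - sv a|; elim: k a b => // k IH a b kab h.
have [ab hS] := camP _ _ _ h.
have hm (m : T n) : sv a < sv m -> sv m < sv b -> if is_up up m then cam C m b else cam C a m.
  exact: cam_avoiding h.
case: (boolP [exists m : T n, [&& sv a < sv m, sv m < sv b & if is_up up m then cam C a m else cam C m b]]).
  case/existsP=> m /and3P[am mb cm].
  have [c1 c2] : cam C a m /\ cam C m b by move: cm (hm m am mb); case: ifP.
  by apply: bc_trans bJ _ _ _ (IH _ _ _ c1) (IH _ _ _ c2); lia.
move/existsPn => nm.
(* If (a, m) were in C, it would be in [cam C]: demanded pairs ending below m are already demanded
   for (a, b), and a pair (c, m) with c up comes from splitting (a, m) at c, where (a, c) is
   excluded by induction. *)
have C1 (m : T n) : sv a < sv m -> sv m < sv b -> is_up up m -> ~~ C a m.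
  have [l] := ubnP `|sv m - sv a|; elim: l m => // l IHl m ml am mb um.
  apply/negP => Cam; have := nm m; rewrite am mb um /= => /camP[]; split=> // c d ac cd dm hc hd.
  have db : sv d <= sv b by lia.
  case: (ltrgtP (sv d) (sv m)) dm => // [dm|/sv_inj edm] _.
    by apply: hS => //; case: hd => [ed|]; [move: dm; rewrite ed; lia | right].
  rewrite edm; case: hc => [->//|uc].
  case: (ltrgtP (sv a) (sv c)) ac => // [ac|/sv_inj <- //] _.
  rewrite edm in cd.
  by have := bc_cotrans bC ac cd Cam; rewrite (negbTE (IHl c _ ac _ uc)) //; lia.
have C2 (m : T n) : sv a < sv m -> sv m < sv b -> ~~ is_up up m -> ~~ C m b.
  have [l] := ubnP `|sv b - sv m|; elim: l m => // l IHl m ml am mb um.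
  apply/negP => Cmb; have := nm m; rewrite am mb (negbTE um) /= => /camP[]; split=> // c d mc cd db hc hd.
  have ac : sv a <= sv c by lia.
  case: (ltrgtP (sv m) (sv c)) mc => // [mc|/sv_inj emc] _.
    by apply: hS => //; case: hc => [ec|]; [move: mc; rewrite ec; lia | right].
  rewrite -emc; case: hd => [->//|ud].
  case: (ltrgtP (sv d) (sv b)) db => // [db|/sv_inj -> //] _.
  rewrite -emc in cd.
  by have := bc_cotrans bC cd db Cmb; rewrite (negbTE (IHl d _ _ db ud)) ?orbF //; lia.
(* The first interior vertex u of a longer chain would put both (a, u) and (u, b) in C, against [C1]
   or [C2]; so the chain is a single step. *)
have step : E a b || F a b.
  have /andP[_ /connectP[[|u p] /= ]] : C a b by exact: cam_sub h.
    by move=> _ e; move: ab; rewrite e; lia.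
  case/andP=> e pu lb.
  have Cau : C a u by case/orP: e => [/(joinr_l F bE)|/(joinr_r E bF)].
  have Cub : u != b -> C u b.
    move=> ub; have cub : connect (relU E F) u b by apply/connectP; exists p.
    rewrite /C /joinr cub andbT lt_neqAle (inj_eq (@sv_inj n)) ub /=.
    apply: (connect_closed (I := fun v => sv u <= sv v) _ cub) => // c d e'.
    have : sv c < sv d by case/orP: e' => [/(bc_lt bE)|/(bc_lt bF)].
    by lia.
  case: (eqVneq u b) => [<- //|/Cub {}Cub].
  case: (boolP (is_up up u)) => uu.
    by have := C1 u (bc_lt bC Cau) (bc_lt bC Cub) uu; rewrite Cau.
  by have := C2 u (bc_lt bC Cau) (bc_lt bC Cub) uu; rewrite Cub.
have key G : biclosed G -> (forall u v, G u v -> C u v) -> G a b -> cam G a b.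
  move=> bG GC Gab; apply/camP; split=> // c d ac cd db hc hd.
  have Gcb : G c b.
    case: hc => [->//|uc]; case: (ltrgtP (sv a) (sv c)) ac => // [ac|/sv_inj <- //] _.
    have cb : sv c < sv b by lia.
    have := bc_cotrans bG ac cb Gab; case/orP=> // /GC; have := C1 c ac cb uc; by case: (C _ _).
  case: hd => [->//|ud]; case: (ltrgtP (sv d) (sv b)) db => // [db|/sv_inj -> //] _.
  have ad : sv a < sv d by lia.
  have := bc_cotrans bG cd db Gcb; case/orP=> // /GC; have := C2 d ad db ud; by case: (C _ _).
case/orP: step => [Eab|Fab].
  apply: joinr_l; first exact: cam_biclosed.
  by apply: key => // u v; exact: joinr_l.
apply: joinr_r; first exact: cam_biclosed.
by apply: key => // u v; exact: joinr_r.
Qed.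

Lemma cam_congr E F a b : (forall u v, E u v = F u v) -> cam E a b = cam F a b.
Proof. by move=> e; apply/idP/idP; apply: cam_mono => u v; rewrite e. Qed.

Lemma class_bottom_exists : exists f : {perm T n} -> {perm T n}, forall x, signed x ->
  signed (f x) /\ forall a b, inverted (f x) a b = cam (inverted x) a b.
Proof.
(* The default 1 is never reached when [x] is signed. *)
exists (fun x => odflt 1%g
  [pick y | signed y && [forall a, forall b, inverted y a b == cam (inverted x) a b]]).
move=> x /inverted_biclosed /cam_biclosed /perm_of_biclosed [y sy ey].
case: pickP => [z /andP[sz /forallP ez]|/(_ y)] /=.
  by split=> // a b; exact/eqP/(forallP (ez a)).
by rewrite sy; case/negP; apply/forallP => a; apply/forallP => b; rewrite ey.
Qed.

Definition fiber x y :=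
  [/\ signed x, signed y & forall a b, cam (inverted x) a b = cam (inverted y) a b].

Lemma fiber_congruence : lattice_congruence fiber.
Proof.
split; first by move=> x sx; split.
split; first by move=> x y [sx sy e]; split.
split; first by move=> x y z [sx _ e1] [_ sz e2]; split=> // a b; rewrite e1.
split=> x y z m1 m2 sx sy sz [_ _ e] h1 h2; have [s1 _] := h1; have [s2 _] := h2;
  split=> // a b; have [bx b_y bz] := And3 (inverted_biclosed sx) (inverted_biclosed sy)
                                      (inverted_biclosed sz).
- rewrite (cam_congr a b (is_meetE sx sz h1)) (cam_congr a b (is_meetE sy sz h2)).
  by rewrite (cam_meetr a b bx bz) (cam_meetr a b b_y bz) e.
- rewrite (cam_congr a b (is_joinE sx sz h1)) (cam_congr a b (is_joinE sy sz h2)).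
  by rewrite (cam_joinr a b bx bz) (cam_joinr a b b_y bz); exact: joinr_congr.
Qed.

Lemma avoidsP x : signed x -> (avoids up x <-> avoiding (inverted x)).
Proof.
move=> sx.
have noup : avoids up x -> forall a b c, inverted x a b -> sv a < sv c -> sv c < sv b ->
  is_up up c -> inverted x c b.
  move=> av a b c iab ac cb uc; apply/negPn/negP => ncb; apply: av.
  exists ((x^-1)%g c), ((x^-1)%g b), ((x^-1)%g a); rewrite !permKV; split.
    exact: pos_trichotomy ncb.
  by case/andP: iab.
split=> [av a b c iab ac cb|av].
  case: ifP => uc; first exact: (noup av a b c).
  rewrite -[a]negTK -[c]negTK; apply: (bc_sym (inverted_biclosed sx)).
  apply: (noup av _ (negT a) _ (bc_sym (inverted_biclosed sx) iab)); rewrite ?svN ?is_upN ?uc //; lia.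
case=> p [q [r [pq [qr [rp [pq' uu]]]]]].
have := av (x r) (x q) (x p); rewrite /inverted /pos !permK uu; lia.
Qed.

End Cambrian.

(** * Inversions of the generating pairs of the congruence *)

Section CambrianPairs.
Variables (n : nat) (up : 'I_n -> bool).
Implicit Types (a b c d u v : T n) (x y : {perm T n}) (z w : int) (E F G : rel (T n)) (j : 'I_n).

Lemma gz_fix (k : nat) (z : int) : (k == 0%N) || (`|z|%N != k) -> `|z|%N != k.+1 -> gz k z = z.
Proof. by rewrite /gz => h1 h2; do !case: ifP; lia. Qed.

(** The inversions of t for the edge between s_(d-1) and s_d, as pairs of integers: t is s_(d-1) if
    d is up and s_d if d is down. *)
Definition simple_pair (isup : bool) (d : nat) (z w : int) : bool :=
  if isup then
    if d == 1%N then (z == -1) && (w == 1)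
    else ((z == d%:Z - 1) && (w == d)) || ((z == - d%:Z) && (w == 1 - d%:Z))
  else ((z == d) && (w == d%:Z + 1)) || ((z == - d%:Z - 1) && (w == - d%:Z)).

(** The further inversions of the element with word tst (for d = 1) or ts (for d > 1). *)
Definition extra_pair (isup : bool) (d : nat) (z w : int) : bool :=
  if d == 1%N then
    ((z == -1) && (w == 2)) || ((z == -2) && (w == 1)) || ((z == -2) && (w == 2))
  else ((z == d%:Z - 1) && (w == d%:Z + 1)) || ((z == - d%:Z - 1) && (w == 1 - d%:Z)).

Lemma pos_gen j v : pos (gen j) v = gz j (sv v).
Proof. by rewrite /pos genV sv_gen. Qed.

Lemma inverted_gen j u v : inverted (gen j) u v = flips j u v.
Proof. by rewrite /inverted !pos_gen. Qed.

Lemma inverted_cam_pair1 j u v : (0 < j)%N ->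
  inverted (cam_pair up j).1 u v = simple_pair (up (prev_ord j)) j (sv u) (sv v).
Proof.
move=> j0; rewrite /cam_pair /simple_pair.
case: (up _) => /=; rewrite inverted_gen; apply/idP/idP.
- by case/flipsP=> -[/= k0 [-> ->]]; case: eqP; lia.
- by case: eqP => j1 H; apply: flipsI => /=; lia.
- by case/flipsP=> -[/= k0 [-> ->]]; lia.
- by move=> H; apply: flipsI; lia.
Qed.

Lemma gz_l (k : nat) : gz k.+1 k.+1 = k.+2.
Proof. by rewrite /gz eqxx. Qed.

Lemma gz_r (k : nat) : gz k.+1 k.+2 = k.+1.
Proof. by rewrite /gz eqxx /=; case: ifP => //; lia. Qed.

Lemma gz_eq (k : nat) z w : (gz k z == w) = (z == gz k w).
Proof. exact: (can2_eq (gzK k) (gzK k)). Qed.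

Definition flipsz (k : nat) z w : bool :=
  if k == 0%N then (z == -1) && (w == 1)
  else ((z == k) && (w == k.+1)) || ((z == - k.+1%:Z) && (w == - k%:Z)).

Lemma flipsE (k : nat) u v : flips k u v = flipsz k (sv u) (sv v).
Proof.
apply/idP/idP; first by case/flipsP=> -[k0 [-> ->]]; rewrite /flipsz; case: eqP; lia.
by rewrite /flipsz; case: eqP => k0 H; apply: flipsI; lia.
Qed.

Lemma flipsN_lt j u v : sv u < sv v -> ~~ flips j u v -> sv (gen j u) < sv (gen j v).
Proof.
rewrite /flips !sv_gen => uv; rewrite uv /=.
have : gz j (sv u) = gz j (sv v) -> sv u = sv v by move/(can_inj (gzK j)).
lia.
Qed.

Lemma inverted_gen_comp j x u v : sv u < sv v -> inverted (Defs.comp (gen j) x) u v =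
  if flips j u v then ~~ inverted x (gen j v) (gen j u) else inverted x (gen j u) (gen j v).
Proof.
rewrite /inverted /flips !pos_gen_comp !sv_gen => uv; rewrite uv /=.
have : pos x (gen j u) = pos x (gen j v) -> sv u = sv v by move/pos_inj/perm_inj ->.
have : gz j (sv u) = gz j (sv v) -> sv u = sv v by move/(can_inj (gzK j)).
by case: ifP; lia.
Qed.

Lemma inverted_cam_pair2 j u v : (0 < j)%N ->
  inverted (cam_pair up j).2 u v =
  simple_pair (up (prev_ord j)) j (sv u) (sv v) || extra_pair (up (prev_ord j)) j (sv u) (sv v).
Proof.
move=> j0; rewrite /cam_pair /simple_pair /extra_pair.
have hu := sv_bound u; have hv := sv_bound v.
have [j1|[d jd]] : j = 1%N :> nat \/ exists d : nat, j = d.+2 :> nat.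
  by case: (nat_of_ord j) j0 => // -[|d] _; [left | right; exists d].
- have c02 : gz 0 2 = 2 by []. have c0n2 : gz 0 (-2) = -2 by [].
  have c01 : gz 0 1 = -1 by []. have c0n1 : gz 0 (-1) = 1 by [].
  have c11 : gz 1 1 = 2 by []. have c12 : gz 1 2 = 1 by [].
  have c1n1 : gz 1 (-1) = -2 by []. have c1n2 : gz 1 (-2) = -1 by [].
  case: (ltrP (sv u) (sv v)) => uv; last first.
    by rewrite j1 /=; case: (up _); rewrite /inverted; lia.
  have j01 : prev_ord j = 0%N :> nat by rewrite /= j1.
  case: (up _); rewrite /= j1 /=.
    rewrite inverted_gen_comp //; case: (boolP (flips _ _ _)) => [|f].
      rewrite flipsE j01 => /andP[/eqP eu /eqP ev].
      by rewrite /inverted !pos_gen_comp !pos_gen !sv_gen eu ev j01 j1.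
    rewrite inverted_gen_comp ?flipsN_lt // !inverted_gen !flipsE !sv_gen j01 j1.
    by move: f; rewrite flipsE j01 /flipsz /= !gz_eq !(c01, c0n1, c02, c0n2, c11, c12, c1n1, c1n2);
      case: ifP; lia.
  rewrite inverted_gen_comp //; case: (boolP (flips _ _ _)) => [|f].
    rewrite flipsE j1 => /orP[] /andP[/eqP eu /eqP ev];
    by rewrite /inverted !pos_gen_comp !pos_gen !sv_gen eu ev j01 j1.
  rewrite inverted_gen_comp ?flipsN_lt // !inverted_gen !flipsE !sv_gen j01 j1.
  by move: f; rewrite flipsE j1 /flipsz /= !gz_eq !(c01, c0n1, c02, c0n2, c11, c12, c1n1, c1n2);
      case: ifP; lia.
- have gN := gzN.
  case: (ltrP (sv u) (sv v)) => uv; last first.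
    by rewrite jd /=; case: (up _); rewrite /inverted; lia.
  have jd1 : prev_ord j = d.+1 :> nat by rewrite /= jd.
  have f13 : gz d.+1 d.+3 = d.+3 by rewrite gz_fix //; lia.
  have f21 : gz d.+2 d.+1 = d.+1 by rewrite gz_fix //; lia.
  case: (up _); rewrite /= jd /= inverted_gen_comp // !inverted_gen !flipsE !sv_gen jd jd1.
    by rewrite /flipsz /= !gz_eq !gzN !(gz_l, gz_r, f13, f21); case: ifP; lia.
  by rewrite /flipsz /= !gz_eq !gzN !(gz_l, gz_r, f13, f21); case: ifP; lia.
Qed.

Lemma signed_cam_pair j : signed (cam_pair up j).1 /\ signed (cam_pair up j).2.
Proof.
by rewrite /cam_pair; case: (up _); case: eqP => _ /=; rewrite !signed_comp ?signed_gen.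
Qed.

(** Every extra inversion has d or -d strictly between its ends, and [cam] then demands a pair that
    is not inverted; so no extra inversion survives. *)
Lemma cam_pair_fiber j : (0 < j)%N -> fiber up (cam_pair up j).1 (cam_pair up j).2.
Proof.
move=> j0; have [s1 s2] := signed_cam_pair j; split=> // a b.
apply/idP/idP => h.
  by apply: cam_mono h => u v; rewrite inverted_cam_pair1 // inverted_cam_pair2 // => ->.
apply: (cam_max _ (@cam_avoiding n up _) _ h); first by move=> u v /camP[].
move=> {h} {}a {}b h; have av := cam_avoiding h.
have tab := cam_sub h; have tav u v := @cam_sub n up (inverted (cam_pair up j).2) u v.
pose e : T n := (prev_ord j, false).
have ee : sv e = j by rewrite /e /Defs.sval /= prednK.
have ue : is_up up e = up (prev_ord j) by [].
have K1 : sv a < sv e -> sv e < sv b -> if up (prev_ord j)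
    then inverted (cam_pair up j).2 e b else inverted (cam_pair up j).2 a e.
  by move=> h1 h2; have := av e h1 h2; rewrite ue; case: (up _) => /tav.
have K2 : sv a < sv (negT e) -> sv (negT e) < sv b -> if up (prev_ord j)
    then inverted (cam_pair up j).2 a (negT e) else inverted (cam_pair up j).2 (negT e) b.
  by move=> h1 h2; have := av (negT e) h1 h2; rewrite is_upN ue; case: (up _) => /tav.
(* This excludes (-2, 2) when d = 1 is down: both splits at 1 and at -1 are inverted there, but the
   demanded pair (-1, 1) is not. *)
have K3 : sv a < sv (negT e) -> sv e < sv b -> sv (negT e) < sv e ->
    up (prev_ord j) || inverted (cam_pair up j).2 (negT e) e.
  move=> h1 h2 h3; have [_ hS] := camP _ _ _ _ h; case: (boolP (up _)) => // nu.
  by apply: hS => //; [exact: ltW | exact: ltW | right; rewrite is_upN ue | right; rewrite ue].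
move: tab K1 K2 K3; rewrite inverted_cam_pair1 // !inverted_cam_pair2 // svN ee.
case/orP => [-> //|]; rewrite /simple_pair /extra_pair.
case: (eqVneq (j : nat) 1%N) => [->|j1]; case: (up _).
- by do ?case/orP; case/andP=> /eqP -> /eqP -> K1 K2 K3; lia.
- by do ?case/orP; case/andP=> /eqP -> /eqP -> K1 K2 K3; lia.
- by case/orP; case/andP=> /eqP -> /eqP -> K1 K2 _; lia.
- by case/orP; case/andP=> /eqP -> /eqP -> K1 K2 _; lia.
Qed.

End CambrianPairs.

(** * Congruent pairs obtained from a generating pair and a parabolic element *)

Section GeneratedPair.
Variables (n : nat) (up : 'I_n -> bool) (R : {perm T n} -> {perm T n} -> Prop).
Hypothesis congR : lattice_congruence R.
Hypothesis genR : forall j : 'I_n, (0 < j)%N -> R (cam_pair up j).1 (cam_pair up j).2.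
Implicit Types (a b c u v : T n) (x y : {perm T n}) (E F G : rel (T n)) (j : 'I_n).

Lemma congr_refl x : signed x -> R x x.
Proof. by case: congR => h _; exact: h. Qed.

Lemma congr_sym x y : R x y -> R y x.
Proof. by case: congR => _ [h _]; exact: h. Qed.

Lemma congr_trans x y z : R x y -> R y z -> R x z.
Proof. by case: congR => _ [_ [h _]]; exact: h. Qed.

Lemma congr_meet x y z m1 m2 : signed x -> signed y -> signed z -> R x y ->
  is_meet x z m1 -> is_meet y z m2 -> R m1 m2.
Proof. by case: congR => _ [_ [_ [h _]]]; exact: h. Qed.

Lemma congr_join x y z m1 m2 : signed x -> signed y -> signed z -> R x y ->
  is_join x z m1 -> is_join y z m2 -> R m1 m2.
Proof. by case: congR => _ [_ [_ [_ h]]]; exact: h. Qed.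

(* Inversions of the longest element of the parabolic subgroup generated by the s_i, i <> d - 1, d. *)
Definition blocks (d : int) : rel (T n) := fun u v =>
  [&& sv u < sv v, ~~ ((sv u <= d) && (d <= sv v)) & ~~ ((sv u <= - d) && (- d <= sv v))].

Lemma blocks_biclosed d : biclosed (blocks d).
Proof. by split; rewrite /blocks => *; rewrite ?svN; lia. Qed.

(** Both elements of the generating pair for d = |c| are joined with the element whose inversions
    are [blocks d]. The bounds on [p] define a transitive relation containing both joinands; the
    inversions of [q] are reached by explicit chains. *)
Lemma generated_pair c : is_up up c -> `|sv c| < n -> exists p q,
  [/\ signed p, signed q, R p q,
      (forall u v, inverted p u v -> [&& sv u != sv c, sv v != - sv c,
         ~~ ((sv u < sv c) && (sv c < sv v)) & ~~ ((sv u < - sv c) && (- sv c < sv v))]) &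
      (forall u v, sv u < sv v -> sv u < sv c ->
         (if 0 < sv c then sv v != - sv c else (sv c == -1) || (sv v < - sv c)) ->
         inverted q u v)].
Proof.
move=> uc cn; have hc := sv_bound c; pose d := `|sv c|%N.
have dn : (d < n)%N by rewrite /d; lia.
have d0 : (0 < d)%N by rewrite /d; lia.
have dE : d = c.1.+1 by rewrite /d /Defs.sval; case: (c.2); lia.
pose j := Ordinal dn.
(* As c is up and equals d or -d, its sign records the orientation of the edge. *)
have uj : up (prev_ord j) = (0 < sv c).
  have -> : prev_ord j = c.1 by apply: val_inj; rewrite /= dE.
  by move: uc; rewrite /is_up /Defs.sval; case: (c.2); [move/negbTE -> |move=> ->]; lia.
have [s1 s2] := signed_cam_pair up j.
have i1 u v := inverted_cam_pair1 up u v (d0 : (0 < j)%N).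
have i2 u v := inverted_cam_pair2 up u v (d0 : (0 < j)%N).
have r12 : R (cam_pair up j).1 (cam_pair up j).2 := genR (d0 : (0 < j)%N).
move: s1 s2 i1 i2 r12; rewrite uj -[nat_of_ord j]/d.
move: (cam_pair up j).1 (cam_pair up j).2 => t t' s1 s2 i1 i2 r12.
have bZ := blocks_biclosed (d%:Z).
have [z sz ez] := perm_of_biclosed bZ.
have [p [jp ep]] := join_exists s1 sz; have [q [jq eq]] := join_exists s2 sz.
have sp := jp.1; have sq := jq.1.
exists p, q; split=> //; first exact: congr_join jp jq.
  move=> u v; rewrite ep => H.
  pose G : rel (T n) := fun u v => [&& sv u < sv v, sv u != sv c, sv v != - sv c,
    ~~ ((sv u < sv c) && (sv c < sv v)) & ~~ ((sv u < - sv c) && (- sv c < sv v))].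
  suff /and5P[_ -> -> -> ->] : G u v by [].
  apply: joinr_min H; rewrite /G.
  - by move=> *; lia.
  - move=> {}u {}v; rewrite i1 /simple_pair /d.
    by case: (ltrP 0 (sv c)) => c0; [case: eqP | ]; lia.
  - by move=> {}u {}v; rewrite ez /blocks /d; lia.
have bq := inverted_biclosed sq.
pose J : rel (T n) := fun u v => (u == v) || inverted q u v.
have Zq u v : blocks d u v -> inverted q u v.
  by move=> h; rewrite eq joinr_r ?ez //; exact: inverted_biclosed.
have JZ u v : sv u <= sv v -> (sv u < sv v -> blocks d u v) -> J u v.
  rewrite /J; case: (ltrgtP (sv u) (sv v)) => [_ _ h|//|/sv_inj -> _ _]; last by rewrite eqxx.
  by rewrite Zq ?h ?orbT.
have Jt u v : simple_pair (0 < sv c) d (sv u) (sv v) || extra_pair (0 < sv c) d (sv u) (sv v) ->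
    inverted q u v.
  by move=> h; rewrite eq joinr_l // ?i2 //; exact: inverted_biclosed.
(* The shape of the chains below: a core inversion with an inversion or an equality on either
   side. *)
have go u u' v' v : J u u' -> inverted q u' v' -> J v' v -> inverted q u v.
  move=> /orP[/eqP ->|h1] h2 /orP[/eqP <-|h3] //; first exact: bc_trans bq _ _ _ h2 h3.
    exact: bc_trans bq _ _ _ h1 h2.
  exact: bc_trans bq _ _ _ h1 (bc_trans bq h2 h3).
have JJ u v w : J u v -> J v w -> J u w.
  rewrite /J => /orP[/eqP -> //|h1] /orP[/eqP <-|h2]; first by rewrite h1 orbT.
  by rewrite (bc_trans bq h1 h2) orbT.
have Jrefl u : J u u by rewrite /J eqxx.
have Ji u v : inverted q u v -> J u v by rewrite /J => ->; rewrite orbT.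
have hd : d%:Z = `|sv c| by rewrite /d; lia.
have [e2 he2] : exists e : T n, sv e = d%:Z + 1 by apply: sv_surj; lia.
move=> u v uv uc'; have hu := sv_bound u; have hv := sv_bound v.
(* Four cases: d = 1, where m(s_0, s_1) = 4, or d > 1, each with c = d or c = -d. For d > 1 the
   value d - 1 exists and serves as an intermediate point. *)
case: (eqVneq d 1%N) => d1; case: (ltrP 0 (sv c)) Jt => c0 Jt Q.
- have Jt1 u' v' : sv u' < 0 -> -2 <= sv u' -> 0 < sv v' -> sv v' <= 2 -> inverted q u' v'.
    move=> *; apply: Jt; rewrite /simple_pair /extra_pair d1 /=.
    by have := sv_bound u'; have := sv_bound v'; lia.
  case: (ltrP (sv v) 0) => v0.
    by apply: Zq; rewrite /blocks; lia.
  apply: (go u (if sv u == -1 then u else negT e2) (if sv v == 1 then v else e2) v).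
  + by case: (eqVneq (sv u) (-1)) => hu1; [exact: Jrefl | apply: JZ; rewrite /blocks svN; lia].
  + by apply: Jt1; case: eqVneq => h; rewrite ?svN; lia.
  + by case: (eqVneq (sv v) 1) => hu1; [exact: Jrefl | apply: JZ; rewrite /blocks; lia].
- have Jt1 u' v' : sv u' = -2 -> sv v' <= 2 -> -2 < sv v' -> inverted q u' v'.
    move=> *; apply: Jt; rewrite /simple_pair /extra_pair d1 /=.
    by have := sv_bound u'; have := sv_bound v'; lia.
  case: (ltrP (sv v) (-1)) => v0.
    by apply: Zq; rewrite /blocks; lia.
  apply: (go u (negT e2) (if sv v <= 1 then v else e2) v).
  + by apply: JZ; rewrite /blocks svN; lia.
  + by apply: Jt1; rewrite ?svN; try case: ifP; lia.
  + by case: ifP => hu1; [exact: Jrefl | apply: JZ; rewrite /blocks; lia].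
- have [e1 he1] : exists e : T n, sv e = d%:Z - 1 by apply: sv_surj; lia.
  have R1 w : sv w <= - d%:Z -> inverted q w (negT e1).
    move=> wd; have [ed|nd] := eqVneq (sv w) (- d%:Z).
      by apply: Jt; rewrite /simple_pair (negbTE d1) ed svN he1; lia.
    apply: (go w (negT e2) (negT e1) (negT e1)); last exact: Jrefl.
      by apply: JZ; rewrite /blocks ?svN he2; lia.
    by apply: Jt; rewrite /extra_pair (negbTE d1) !svN he1 he2; lia.
  have R2 w : sv w < d -> J w e1.
    move=> wd; case: (lerP (sv w) (- d%:Z)) => wd'.
      apply: JJ (Ji _ _ (R1 w wd')) _.
      by apply: JZ; rewrite /blocks ?svN he1; lia.
    by apply: JZ; rewrite /blocks he1; lia.
  have R3 w : d%:Z <= sv w -> inverted q e1 w.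
    move=> dw; have [ed|nd] := eqVneq (sv w) d%:Z.
      by apply: Jt; rewrite /simple_pair (negbTE d1) ed he1; lia.
    apply: (go e1 e1 e2 w); first exact: Jrefl.
      by apply: Jt; rewrite /extra_pair (negbTE d1) he1 he2; lia.
    by apply: JZ; rewrite /blocks he2; lia.
  case: (lerP d%:Z (sv v)) => dv.
    by apply: (go u e1 v v); [apply: R2; lia | exact: R3 | exact: Jrefl].
  case: (boolP (blocks d u v)) => [/Zq //|nb].
  apply: (go u u (negT e1) v); [exact: Jrefl | apply: R1 | apply: JZ]; move: nb.
  + by rewrite /blocks; lia.
  + by rewrite /blocks svN he1; lia.
  + by rewrite /blocks svN he1; lia.
- have [e1 he1] : exists e : T n, sv e = d%:Z - 1 by apply: sv_surj; lia.
  case: (boolP (blocks d u v)) => [/Zq //|nb].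
  have ue2 : J u (negT e2) by apply: JZ; rewrite /blocks svN he2; lia.
  have [ed|nd] := eqVneq (sv v) (- d%:Z).
    apply: (go u (negT e2) v v) => //.
    by apply: Jt; rewrite /simple_pair ed svN he2; lia.
  apply: (go u (negT e2) (negT e1) v) => //.
    by apply: Jt; rewrite /extra_pair (negbTE d1) !svN he1 he2; lia.
  by move: nb; apply: contraNT => nJ; move: nJ; apply: contraNT => nb;
    apply: JZ; move: nb; rewrite /blocks svN he1; lia.
Qed.

End GeneratedPair.

(* The values A < B sit at the adjacent positions q < p as B, A; exchanging them (and -A, -B)
   moves the value z from position r to position r'. *)
Definition edge_spec (A B p q : int) (z r r' : int) : Prop :=
  [/\ z = A, r = p & r' = q] \/ [/\ z = B, r = q & r' = p] \/
  [/\ z = - A, r = - p & r' = - q] \/ [/\ z = - B, r = - q & r' = - p] \/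
  [/\ [&& z != A, z != B, z != - A & z != - B], r' = r, r < q \/ p < r & r < - p \/ - q < r].

(** [h1] and [h2] say that -q and -p do not lie strictly between q and p. Running through the five
    kinds of value for each of z and w leaves linear arithmetic. *)
Lemma edge_arith (A B p q z r r' w s s' : int) : A < B -> q < p -> A != 0 -> B != 0 -> p != 0 -> q != 0 ->
  (0 <= q) || (p <= - q) -> (- p <= q) || (p <= 0) -> (B == - A) = (q == - p) ->
  edge_spec A B p q z r r' -> edge_spec A B p q w s s' -> z < w ->
  (s' < r') = [&& s < r, ~~ ((z == A) && (w == B)) & ~~ ((z == - B) && (w == - A))].
Proof.
move=> AB qp A0 B0 p0 q0 h1 h2 h3.
case=> [[-> -> ->]|[[-> -> ->]|[[-> -> ->]|[[-> -> ->]|[/and4P[v1 v2 v3 v4] -> v5 v6]]]]].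
5: rewrite (negbTE v1) (negbTE v4) /= andbT; clear v1 v2 v3 v4.
all: case=> [[-> -> ->]|[[-> -> ->]|[[-> -> ->]|[[-> -> ->]|[/and4P[u1 u2 u3 u4] -> u5 u6]]]]] zw.
all: try (rewrite (negbTE u2) (negbTE u3) !andbF; clear u1 u2 u3 u4).
all: lia.
Qed.

(** * Contracting the exchange of two adjacent entries *)

Section EdgeContraction.
Variables (n : nat) (up : 'I_n -> bool) (R : {perm T n} -> {perm T n} -> Prop).
Hypothesis congR : lattice_congruence R.
Hypothesis genR : forall j : 'I_n, (0 < j)%N -> R (cam_pair up j).1 (cam_pair up j).2.
Implicit Types (a b c u v : T n) (x y : {perm T n}) (E F G : rel (T n)) (j : 'I_n).

(* V keeps the inversions of y inside the value blocks of p cut out by c and -c and inverts all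
   pairs across blocks, so that V meets p below y, whereas V meets q in the required pairs. *)
Lemma contract y c : signed y -> is_up up c -> `|sv c| < n -> exists y1,
  [/\ signed y1, R y y1, (forall u v, inverted y u v -> inverted y1 u v) &
    forall a b, sv a < sv c -> sv c < sv b ->
      (if 0 < sv c then
         if sv a < - sv c then pos y c < - pos y c else pos y c < pos y a
       else (pos y c < pos y a) && ((sv c == -1) || (sv b < - sv c))) -> inverted y1 a b].
Proof.
move=> sy uc cn; have hc := sv_bound c.
have [p [q [sp sq Rpq hp hq]]] := generated_pair congR genR uc cn.
pose V : rel (T n) := fun u v => (sv u < sv v) &&
  [|| (sv u <= sv c) && (sv c < sv v), (sv u < - sv c) && (- sv c <= sv v) | inverted y u v].
have b_y := inverted_biclosed sy.
have bV : biclosed V.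
  split; rewrite /V.
  - by move=> u v /andP[].
  - by move=> u v w; have := bc_trans b_y (a := u) (b := v) (c := w); lia.
  - by move=> u v w uv vw; have := bc_cotrans b_y uv vw; lia.
  - by move=> u v; rewrite !svN; have := bc_sym b_y (a := u) (b := v); lia.
have [w sw ew] := perm_of_biclosed bV.
have [m1 [im1 em1]] := meet_exists sp sw; have [m2 [im2 em2]] := meet_exists sq sw.
have [sm1 sm2] := (im1.1, im2.1).
have [y1 [jy1 ey1]] := join_exists sm2 sy.
have bp := inverted_biclosed sp; have bw := inverted_biclosed sw.
have R12 : R m1 m2 by exact: (congr_meet congR sp sq sw Rpq im1 im2).
(* A pair inverted by both [p] and [V] lies within one block, where [V] agrees with [y]; hence [m1]
   is below [y]. *)
have jy : is_join m1 y y.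
  do 2!split=> //; last by split=> [t|z _ _].
  apply/(weak_leP sm1 sy) => u v; rewrite em1 => /(meetr_sub bp bw)[/hp h].
  by rewrite ew /V; lia.
have sy1 := jy1.1.
exists y1; split=> //; first exact: (congr_join congR sm1 sm2 sy R12 jy jy1).
  by move=> u v h; rewrite ey1; apply: joinr_r.
move=> a b ac cb cond; rewrite ey1; apply: joinr_l; first exact: inverted_biclosed.
rewrite em2.
(* A set containing a and not b that no non-inversion of [q] or of [V] leaves, as required to place
   (a, b) in the meet [m2]. *)
pose I (v : T n) := if 0 < sv c then
   (sv v < sv c) && (if sv v < - sv c then pos y c < - pos y c else pos y c < pos y v)
  else (sv v < sv c) && (pos y c < pos y v) || ~~ ((sv c == -1) || (sv v < - sv c)).
have posc v : sv v = - sv c -> pos y v = - pos y c.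
  by move=> e; rewrite -posN //; congr pos; apply: sv_inj; rewrite svN.
have posc' v : sv v = sv c -> pos y v = pos y c by move/sv_inj ->.
apply: (meetr_closed (I := I)).
- exact: lt_trans cb.
- move=> u v uv nq; have := hq u v uv; rewrite (negbTE nq) => {}hq; clear cond hc cn ac cb.
  have := posc v; rewrite /I; case: (ltrP 0 (sv c)) hq => c0 hq; last by lia.
  by case: ifP => h1; case: ifP => h2; lia.
- move=> u v uv; rewrite ew /V uv => nV; clear cond hc cn ac cb.
  have pt := @pos_trichotomy _ y u v uv; have := posc' v; move: nV pt.
  by rewrite /I; case: (ltrP 0 (sv c)) => c0; [case: ifP => h1; case: ifP => h2 | ]; lia.
- by rewrite /I; case: ifP cond => c0; [case: ifP | ]; lia.
- by rewrite /I; case: ifP cond => c0; [case: ifP; case: ifP | ]; lia.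
Qed.

Section Edge.
Variables (x : {perm T n}) (a b : T n).
Hypotheses (sx : signed x) (ab : sv a < sv b) (pba : pos x b < pos x a).
Hypothesis adj : forall v, pos x v <= pos x b \/ pos x a <= pos x v.

Let x' := Defs.comp (rf a b) x.

Lemma signed_edge : signed x'.
Proof.
apply: signed_comp => //; apply/signedP => v; apply: sv_inj.
have h : sv a != sv b by lia.
have := sv_bound v; have := sv_bound a; have := sv_bound b => hb ha hv.
by rewrite svN !rfE // !svN; do !case: ifP; lia.
Qed.

Lemma pos_edge v : edge_spec (sv a) (sv b) (pos x a) (pos x b) (sv v) (pos x v) (pos x' v).
Proof.
have h : sv a != sv b by lia.
have p'E : pos x' v = pos x (rf a b v) by rewrite pos_comp rfK.
have := rfE v h; rewrite /edge_spec p'E.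
case: eqP => [/sv_inj -> /sv_inj ->|va]; first by left.
case: eqP => [/sv_inj -> /sv_inj ->|vb]; first by right; left.
rewrite -(svN a) -(svN b); case: eqP => [/sv_inj -> /sv_inj ->|vna].
  by right; right; left; rewrite !posN.
case: eqP => [/sv_inj -> /sv_inj ->|vnb].
  by right; right; right; left; rewrite !posN.
move=> /sv_inj ->; do 4!right; split=> //.
- have := adj v; have : pos x v <> pos x a by move/pos_inj => e; case: va; rewrite e.
  have : pos x v <> pos x b by move/pos_inj => e; case: vb; rewrite e.
  by lia.
- have := adj (negT v); rewrite posN //.
  have : pos x v <> - pos x a by rewrite -posN // => /pos_inj e; case: vna; rewrite e.
  have : pos x v <> - pos x b by rewrite -posN // => /pos_inj e; case: vnb; rewrite e.
  by lia.
Qed.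

Lemma inverted_edge u v : inverted x' u v = [&& inverted x u v,
  ~~ ((sv u == sv a) && (sv v == sv b)) & ~~ ((sv u == - sv b) && (sv v == - sv a))].
Proof.
have := adj (negT a); have := adj (negT b); rewrite !posN // => adjb adja.
rewrite /inverted; case: (boolP (sv u < sv v)) => //= uv.
apply: edge_arith (pos_edge u) (pos_edge v) uv => //.
- by case/andP: (sv_bound a).
- by case/andP: (sv_bound b).
- by case/andP: (pos_bound x a).
- by case/andP: (pos_bound x b).
- by lia.
- by lia.
- by rewrite -posN // -svN (inj_eq (@sv_inj n)) (inj_eq (@pos_inj n x)).
Qed.

(** The meet of [y] with [x] is [x'], because (a, b) and its mirror are the only inversions lost
    from [x]; the meet of [y1] with [x] is [x] itself. *)
Lemma edge_finish y y1 : signed y -> (forall u v, inverted x' u v -> inverted y u v) ->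
  ~~ inverted y a b -> signed y1 -> R y y1 -> (forall u v, inverted y u v -> inverted y1 u v) ->
  inverted y1 a b -> R x' x.
Proof.
move=> sy xy nab sy1 Ry yy1 iab.
have sx' := signed_edge.
apply: (congr_meet congR sy sy1 sx Ry).
- split=> //; split; first exact/(weak_leP sx' sy).
  split; first by apply/(weak_leP sx' sx) => u v; rewrite inverted_edge => /andP[].
  move=> z sz /(weak_leP sz sy) zy /(weak_leP sz sx) zx; apply/(weak_leP sz sx') => u v iz.
  rewrite inverted_edge zx //=; have iy := zy _ _ iz; apply/andP; split.
    by apply/negP => /andP[/eqP/sv_inj eu /eqP/sv_inj ev]; move: nab; rewrite -eu -ev iy.
  apply/negP => /andP[/eqP eu /eqP ev]; move: nab.
  have -> : a = negT v by apply: sv_inj; rewrite svN ev opprK.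
  have -> : b = negT u by apply: sv_inj; rewrite svN eu opprK.
  by rewrite (bc_sym (inverted_biclosed sy) iy).
- split=> //; split; last by split.
  apply/(weak_leP sx sy1) => u v iu.
  case: (boolP (inverted x' u v)) => [/xy/yy1 //|].
  rewrite inverted_edge iu /= -negb_or negbK => /orP[]/andP[/eqP eu /eqP ev].
    by move/sv_inj: eu => ->; move/sv_inj: ev => ->.
  have -> : u = negT b by apply: sv_inj; rewrite svN.
  have -> : v = negT a by apply: sv_inj; rewrite svN.
  exact: (bc_sym (inverted_biclosed sy1) iab).
Qed.

Lemma pos_edge_l : pos x' a = pos x b.
Proof.
rewrite pos_comp rfK ?(lt_eqF ab) //; congr pos; apply: sv_inj.
by rewrite rfE ?eqxx // (lt_eqF ab).
Qed.

Lemma pos_edge_r : pos x' b = pos x a.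
Proof.
rewrite pos_comp rfK ?(lt_eqF ab) //; congr pos; apply: sv_inj.
by rewrite rfE ?(lt_eqF ab) // eqxx; case: eqP => // ->.
Qed.

(** Only c = -a or c = -b can move, and adjacency keeps the positions of -a and -b from lying
    strictly between those of b and a. *)
Lemma edge_before c : sv a < sv c -> sv c < sv b -> pos x c < pos x b -> pos x' c < pos x b.
Proof.
move=> ac cb pcb; have := adj (negT b); have := adj (negT a); rewrite !posN // => adja adjb.
have hb := pos_bound x b; have ha := pos_bound x a.
by case: (pos_edge c) => [[]|[[]|[[]|[[]|[]]]]]; lia.
Qed.

Lemma edge_base c : is_up up c -> sv a < sv c -> sv c < sv b -> pos x c < pos x b ->
  (0 < sv c) || (sv c == -1) -> R x' x.
Proof.
move=> uc ac cb pcb hc.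
have sx' := signed_edge; have ha := sv_bound a; have hb := sv_bound b.
have cn : `|sv c| < n by lia.
have pc := edge_before ac cb pcb.
have nab : ~~ inverted x' a b by rewrite inverted_edge !eqxx andbF.
(* In these cases [contract] applies with y = x'. Otherwise a < -c and -c stands to the left of c in
   [x']. *)
have [easy|hard] := boolP [|| sv c == -1, - sv c <= sv a | pos x' c < - pos x' c].
  have [y1 [sy1 R1 h1 h2]] := contract sx' uc cn.
  apply: (edge_finish sx' _ nab sy1 R1 h1) => //; apply: h2 => //.
  by rewrite pos_edge_l; case: ifP => c0; [case: ifP | ]; lia.
(* Sorting the middle block of x', delimited by c and -c, decreasingly puts c before -c. *)
pose i := `|pos x' c|.
pose Y : rel (T n) := fun u v => (sv u < sv v) &&
  ((pos x' v < pos x' u) || (`|pos x' u| <= i) && (`|pos x' v| <= i)).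
have bY : biclosed Y.
  split; rewrite /Y.
  - by move=> u v /andP[].
  - by move=> u v w; lia.
  - by move=> u v w; lia.
  - by move=> u v; rewrite !posN // !svN; lia.
have [y sy ey] := perm_of_biclosed bY.
have c0 : 0 < sv c by lia.
have pc0 : 0 < pos x' c by have := pos_bound x' c; lia.
have [y1 [sy1 R1 h1 h2]] := contract sy uc cn.
apply: (edge_finish sy _ _ sy1 R1 h1).
- by move=> u v; rewrite ey /Y /inverted; lia.
(* The positions of a and b in [x'] both exceed [i], so the sorting does not invert (a, b). *)
- by rewrite ey /Y pos_edge_l pos_edge_r /i; lia.
- apply: h2 => //; rewrite c0.
  have -> : sv a < - sv c by lia.
  have : inverted y (negT c) c by rewrite ey /Y posN // svN /i; lia.
  by rewrite /inverted posN //; lia.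
Qed.

(** What remains is c < -1. Contraction then inverts (a, m) for all m strictly between c and -c,
    which suffices when b < -c. *)
Lemma edge_contracted c : is_up up c -> sv a < sv c -> sv c < sv b -> pos x c < pos x b -> R x' x.
Proof.
move=> uc ac cb pcb; have ha := sv_bound a; have hb := sv_bound b.
have [hc|hc] := boolP ((0 < sv c) || (sv c == -1)); first exact: edge_base hc.
have hc0 := sv_bound c; have cn : `|sv c| < n by lia.
have sx' := signed_edge.
have nab : ~~ inverted x' a b by rewrite inverted_edge !eqxx andbF.
have pc := edge_before ac cb pcb.
have [y1 [sy1 R1 h1 h2]] := contract sx' uc cn.
have {}h2 m : sv c < sv m -> sv m < - sv c -> inverted y1 a m.
  by move=> cm mc; apply: h2 => //; rewrite pos_edge_l ifF; lia.
case: (ltrP (sv b) (- sv c)) => bc.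
  by apply: (edge_finish sx' _ nab sy1 R1 h1) => //; apply: h2.
(* If 1 or -1 lies right of b, it splits (a, b); otherwise the up one of them replaces c. *)
have mid m : `|sv m| < - sv c -> pos x b < pos x m -> R x' x.
  move=> mc pbm; apply: (edge_finish sx' _ nab sy1 R1 h1) => //.
  apply: (bc_trans (inverted_biclosed sy1) (b := m)); first by apply: h2; lia.
  apply: h1; rewrite inverted_edge /inverted pbm; lia.
have [e he] : exists e : T n, sv e = 1 by apply: sv_surj; lia.
have neq m : sv m <> sv b -> pos x m <> pos x b by move=> h /pos_inj e'; apply: h; rewrite e'.
have ne1 := neq e; have ne2 := neq (negT e); rewrite svN in ne2.
case: (ltrP (pos x b) (pos x e)) => [|p1]; first by apply: mid; lia.
case: (ltrP (pos x b) (pos x (negT e))) => [|p2]; first by apply: mid; rewrite svN; lia.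
case: (boolP (is_up up e)) => ue; first by apply: (edge_base ue); lia.
by apply: (@edge_base (negT e)); rewrite ?is_upN // ?svN; lia.
Qed.

End Edge.
End EdgeContraction.

(** * Descent to the bottom of a class, and the isomorphism *)

Section Bottom.
Variables (n : nat) (up : 'I_n -> bool).
Implicit Types (a b c u v : T n) (x y : {perm T n}).

(** An entry standing between b and a replaces a if it is below c, and b if it is above c. *)
Lemma adjacent_pattern x a b c : inverted x a b -> sv a < sv c -> sv c < sv b ->
  pos x c < pos x b -> exists a' b', [/\ inverted x a' b', sv a' < sv c, sv c < sv b',
    pos x c < pos x b' & forall v, pos x v <= pos x b' \/ pos x a' <= pos x v].
Proof.
have [k] := ubnP `|pos x a - pos x b|; elim: k a b => // k IH a b kab iab ac cb pcb.
have [/existsP[v /andP[bv va]]|/existsPn nv] :=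
  boolP [exists v : T n, (pos x b < pos x v) && (pos x v < pos x a)]; last first.
  by exists a, b; split=> // v; have := nv v; lia.
have : sv v != sv c by apply/eqP => /sv_inj e; move: bv; rewrite e; lia.
case: (ltrgtP (sv v) (sv c)) => // [vc|cv] _.
  by apply: (IH v b); rewrite /inverted; lia.
by apply: (IH a v); rewrite /inverted; lia.
Qed.

(** The element [x'] is chosen before [R], so that one descent step serves both an arbitrary
    congruence and [fiber]. *)
Lemma contracted_edge x : signed x -> avoids up x \/ exists x',
  [/\ signed x', (#|[set p : T n * T n | inverted x' p.1 p.2]| <
                  #|[set p : T n * T n | inverted x p.1 p.2]|)%N &
   forall R, lattice_congruence R ->
    (forall j : 'I_n, (0 < j)%N -> R (cam_pair up j).1 (cam_pair up j).2) -> R x' x].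
Proof.
move=> sx; have [/existsP[c /existsP[b /existsP[a /and5P[cb ba ac cb' uc]]]]|no] :=
  boolP [exists c : T n, exists b : T n, exists a : T n, [&& pos x c < pos x b,
    pos x b < pos x a, sv a < sv c, sv c < sv b & is_up up c]]; last first.
  left=> -[p [q [r [pq [qr [rp [pq' uu]]]]]]]; case/negP: no.
  by apply/existsP; exists (x p); apply/existsP; exists (x q); apply/existsP; exists (x r);
    rewrite /pos !permK pq qr rp pq'.
have iab : inverted x a b by rewrite /inverted; lia.
have [a' [b' [i' ac' cb'' pcb adj]]] := adjacent_pattern iab ac cb' cb.
have [ab pba] := andP i'.
right; exists (Defs.comp (rf a' b') x); split.
- exact: signed_edge.
- apply: proper_card; apply/properP; split.
    by apply/subsetP => -[u v]; rewrite !inE /= inverted_edge // => /andP[].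
  by exists (a', b'); rewrite !inE //= inverted_edge // !eqxx andbF.
- by move=> R cR gR; apply: (edge_contracted cR gR _ _ _ _ uc).
Qed.

Lemma congruent_bottom (f : {perm T n} -> {perm T n}) (R : {perm T n} -> {perm T n} -> Prop) x :
  (forall x, signed x -> signed (f x) /\ forall a b, inverted (f x) a b = cam up (inverted x) a b) ->
  lattice_congruence R ->
  (forall j : 'I_n, (0 < j)%N -> R (cam_pair up j).1 (cam_pair up j).2) ->
  signed x -> R x (f x).
Proof.
move=> fP cR gR; have [k] := ubnP #|[set p : T n * T n | inverted x p.1 p.2]|.
elim: k x => // k IH x kx sx; have [sf fE] := fP _ sx.
have [av|[x' [sx' lt h]]] := contracted_edge sx.
  have -> : f x = x.
    apply: inverted_inj => a b; rewrite fE cam_id //; first exact: inverted_biclosed.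
    exact/avoidsP.
  exact: (congr_refl cR).
have [sf' fE'] := fP _ sx'.
(* [fiber] is itself a congruence containing the generating pairs, so the same step leaves [f]
   unchanged. *)
have -> : f x = f x'.
  have [_ _ e] := h _ (fiber_congruence up) (@cam_pair_fiber n up).
  by apply: inverted_inj => a b; rewrite fE fE' e.
apply: (congr_trans cR (congr_sym cR (h _ cR gR))).
by apply: IH => //; lia.
Qed.

End Bottom.

(* C(G) (quotient of the weak order on B_n by Theta(G)) is isomorphic to the
   subposet of the weak order on the signed permutations avoiding bar2-31.
   The isomorphism is given through f : B_n -> B_n, constant on Theta-classes. *)
Theorem theorem7p5 (n : nat) (up : 'I_n -> bool) :
  exists f : {perm T n} -> {perm T n},
    (forall x, signed x -> signed (f x) /\ avoids up (f x)) /\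
    (forall w, signed w -> avoids up w -> exists x, signed x /\ f x = w) /\
    (forall x y, signed x -> signed y -> (f x = f y <-> Theta up x y)) /\
    (forall x y, signed x -> signed y -> (quot_le up x y <-> weak_le (f x) (f y))).
Proof.
have [f fP] := class_bottom_exists up; exists f.
have fid w : signed w -> avoids up w -> f w = w.
  move=> sw /(avoidsP up sw) av; have [_ fE] := fP _ sw.
  by apply: inverted_inj => a b; rewrite fE cam_id //; exact: inverted_biclosed.
have thetaP x y : signed x -> signed y -> (f x = f y <-> Theta up x y).
  move=> sx sy; have [[sfx fx] [sfy fy]] := (fP _ sx, fP _ sy); split=> [e R cR gR|th].
    apply: (congr_trans cR (congruent_bottom fP cR gR sx)); rewrite e.
    exact: (congr_sym cR (congruent_bottom fP cR gR sy)).
  (* [Theta] is the smallest such congruence, hence contained in [fiber]. *)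
  have [_ _ e] := th _ (fiber_congruence up) (@cam_pair_fiber n up).
  by apply: inverted_inj => a b; rewrite fx fy e.
split=> [x sx|].
  have [sf fE] := fP _ sx; split=> //; apply/(avoidsP up sf) => a b c.
  by rewrite !fE; exact: cam_avoiding.
split=> [w sw av|]; first by exists w; split=> //; exact: fid.
split=> // x y sx sy; have [[sfx fx] [sfy fy]] := (fP _ sx, fP _ sy).
split=> [[x' [y' [sx' [sy' [/(thetaP _ _ sx sx') ex [/(thetaP _ _ sy sy') ey le]]]]]]|le].
  rewrite ex ey; have [[sfx' fx'] [sfy' fy']] := (fP _ sx', fP _ sy').
  apply/(weak_leP sfx' sfy') => a b; rewrite fx' fy'; apply: cam_mono.
  exact/(weak_leP sx' sy').
(* The bottoms of the two classes serve as comparable representatives. *)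
exists (f x), (f y); split=> //; split=> //.
by split; [|split=> //]; move=> R cR gR; exact: (congruent_bottom fP cR gR).
Qed.
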